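(* Let $-1/2<s<1/2$ and $f\in L^2(\mathbb{R})$. (1) There is a unique $u\in \widehat{H}^{|s|}(\mathbb{R})$ such that $$\widehat{f}(\xi)=\left((2\pi i \xi)^{-s}+(-2\pi i \xi)^s\right)\widehat{u}(\xi)\quad\text{for a.e. }\xi\in\mathbb{R}.$$ (2) There is a unique $u\in \widehat{H}^{|s|}(\mathbb{R})$ such that $$\widehat{f}(\xi)=\left((2\pi i \xi)^{-s}+(2\pi i \xi)^s\right)\widehat{u}(\xi)\quad\text{for a.e. }\xi\in\mathbb{R}.$$
   Context: All functions are real valued (except Fourier transforms); $L^2(\mathbb{R})$ is the space of real-valued square-integrable functions, identified when equal a.e. $\widehat{w}$ is the Plancherel transform of $w\in L^2(\mathbb{R})$, i.e. the $L^2$-isometric extension of $\mathcal{F}(w)(\xi)=\int_{\mathbb{R}} e^{-2\pi i x\xi}w(x)\,dx$. For $\mu\ge 0$, $\widehat{H}^\mu(\mathbb{R})=\{w\in L^2(\mathbb{R}): \int_{\mathbb{R}}(1+|2\pi\xi|^{2\mu})|\widehat{w}(\xi)|^2\,d\xi<\infty\}$. The complex power functions are understood, for $\xi\neq 0$ and $\sigma\in\mathbb{R}$, as $(\mp i\xi)^{\sigma}=|\xi|^\sigma e^{\mp\sigma\pi i\,\mathrm{sign}(\xi)/2}$, so $(\pm 2\pi i\xi)^{\sigma}=|2\pi\xi|^\sigma e^{\pm\sigma\pi i\,\mathrm{sign}(\xi)/2}$. *)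

(* Defs.v *)
From HB Require Import structures.
From mathcomp Require Import all_boot all_order all_algebra.
From mathcomp Require Import all_classical all_reals all_analysis.
From mathcomp Require Import complex.

Set Implicit Arguments.
Unset Strict Implicit.
Unset Printing Implicit Defensive.
Import Order.TTheory GRing.Theory Num.Theory.
Import numFieldNormedType.Exports.

Local Open Scope classical_set_scope.
Local Open Scope ring_scope.
Local Open Scope complex_scope.

Section Definitions.
Variable R : realType.

Local Notation leb := (@lebesgue_measure R).

Definition L1 : set (R -> R) := [set w | w \in Lfun leb 1%:E].
Definition L2 : set (R -> R) := [set w | w \in Lfun leb 2%:E].

Definition L2C : set (R -> R[i]) :=
  [set g | L2 (fun x => complex.Re (g x)) /\ L2 (fun x => complex.Im (g x))].

Definition normL2 (w : R -> R) : \bar R := Lnorm leb 2%:E (EFin \o w).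

Definition normL2C (g : R -> R[i]) : \bar R :=
  Lnorm leb 2%:E (fun x => (Normc.normc (g x))%:E).

Definition Cintegral (g : R -> R[i]) : R[i] :=
  (\int[leb]_x complex.Re (g x)) +i* (\int[leb]_x complex.Im (g x)).

(* e^(i t) for real t *)
Definition expi (t : R) : R[i] := cos t +i* sin t.

(* Meaningful for integrable [w] only. *)
Definition fourier (w : R -> R) (xi : R) : R[i] :=
  Cintegral (fun x => expi (- (2 * pi * x * xi)) * (w x)%:C).

(* [Phi] is an L^2-isometric extension of the Fourier integral from L^1 n L^2
   to L^2. As L^1 n L^2 is dense in L^2, the values of [Phi] on L^2 are
   determined up to a.e. equality. *)
Definition isometric_extension (Phi : (R -> R) -> R -> R[i]) : Prop :=
  [/\ forall w, L2 w -> L2C (Phi w),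
      forall w v, L2 w -> L2 v ->
        normL2C (fun xi => Phi w xi - Phi v xi) = normL2 (fun x => w x - v x)
    & forall w, L1 w -> L2 w ->
        {ae leb, forall xi, Phi w xi = fourier w xi}].

(* The default value is irrelevant: by Plancherel's theorem such an extension
   exists. Values at arguments outside of L^2 are meaningless. *)
Definition plancherel : (R -> R) -> R -> R[i] :=
  xget (fun _ _ => 0) isometric_extension.

Definition Hhat (mu : R) : set (R -> R) :=
  [set w | L2 w /\
    (\int[leb]_xi ((1 + `|2 * pi * xi| `^ (2 * mu)) *
                   Normc.normc (plancherel w xi) ^+ 2)%:E < +oo)%E].

(* (i xi)^sigma for xi != 0; since Num.sg is odd, (- i xi)^sigma is
   [ipow (- xi) sigma]. The value at xi = 0 is irrelevant. *)
Definition ipow (xi sigma : R) : R[i] :=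
  (`|xi| `^ sigma)%:C * expi (sigma * pi * Num.sg xi / 2).

Definition exists_unique_ae (P : set (R -> R)) : Prop :=
  exists2 u, P u & forall v, P v -> {ae leb, forall x, v x = u x}.

End Definitions.

(* Main.v *)
Require Import Defs.
From HB Require Import structures.
From mathcomp Require Import all_boot all_order all_algebra.
From mathcomp Require Import all_classical all_reals all_analysis.
From mathcomp Require Import measurable_realfun complex.
From mathcomp Require Import ring lra.

Set Implicit Arguments.
Unset Strict Implicit.
Unset Printing Implicit Defensive.
Import Order.TTheory GRing.Theory Num.Theory.
Import numFieldNormedType.Exports.

Local Open Scope classical_set_scope.
Local Open Scope ring_scope.
Local Open Scope complex_scope.

(** Both equations ask for [u] with [plancherel f = m * plancherel u], where the
    symbol [m] vanishes at most at the origin.  Hence [plancherel u] has to be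
    [plancherel f / m], and everything rests on two facts.

    The first one concerns the symbols.  With [a = |2 pi xi| ^ s] and
    [b = |2 pi xi| ^ (- s)], so that [a b = 1], the first symbol has square
    modulus [(a + b) ^ 2] and the second one
    [a ^ 2 + b ^ 2 + 2 cos (s pi)], where [cos (s pi) >= 0] because
    [|s| < 1 / 2].  Both dominate half of the weight
    [1 + |2 pi xi| ^ (2 |s|)] that defines [Hhat `|s|]
    ([weight_le_symbol1], [weight_le_symbol2]), so the quotient has a finite
    weighted norm.  Both symbols take conjugate values at opposite points, so
    the quotient is again hermitian.

    The second one is Plancherel's theorem: the isometric extension of the
    Fourier integral exists, is unique up to null sets, and maps the real
    square-integrable functions onto the hermitian ones.  It is reduced to real
    functions by the Hartley kernel [cas = cos + sin].  The Fourier integral of a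
    real function has the even part of its Hartley integral as real part and
    minus the odd part as imaginary part, so it suffices that the Hartley
    transform is an isometric involution of the real space [L2].  Surjectivity
    then costs nothing: an involution is its own inverse.

    For the Hartley integral [hart], the symmetry of the kernel gives the
    multiplication formula [int (hart f) g = int f (hart g)]
    ([hart_multiplication]).  Applied to [exp (- e |xi|) cas (2 pi y xi)], whose
    Hartley integral is the Poisson kernel [poisson e (y - x)], it shows that
    damping [hart f] by [exp (- e |xi|)] and transforming back yields the Poisson
    mean of [f] ([hart_hart_abel]).  Consequences:
    - the damped integral of [(hart f) ^ 2] equals the integral of [f] against
      its Poisson mean, hence is at most the integral of [f ^ 2], because the
      Poisson kernel has mass at most [1]; letting [e] tend to [0], [hart] is a
      contraction ([hart_contraction]) and extends to [L2] by completeness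
      ([hartL2]);
    - the multiplication formula also moves the Poisson mean from [f] to the
      indicator of an interval, where it is an explicit difference of arctangents
      that tends to the indicator; so transforming [f] twice gives a function
      with the same integrals over intervals as [f], that is [f] itself
      ([hartL2_hartK], [hartL2K]);
    - a contraction that is an involution is an isometry ([hartL2_isometry]). *)

(** * The space of square-integrable functions *)

Section L2.
Variable R : realType.
Local Notation leb := (@lebesgue_measure R).
Implicit Types f g h : R -> R.

Lemma aeS (P Q : R -> Prop) : (forall x, P x -> Q x) ->
  {ae leb, forall x, P x} -> {ae leb, forall x, Q x}.
Proof.
by move=> PQ; apply: filterS; [exact: (ae_filter_ringOfSetsType leb)|exact: PQ].
Qed.

Lemma aeS2 (P Q S : R -> Prop) : (forall x, P x -> Q x -> S x) ->
  {ae leb, forall x, P x} -> {ae leb, forall x, Q x} ->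
  {ae leb, forall x, S x}.
Proof.
move=> PQ; apply: filterS2; first exact: (ae_filter_ringOfSetsType leb).
exact: PQ.
Qed.

Definition nrm f : R := fine (normL2 f).

Lemma normL2E f :
  (normL2 f = (\int[leb]_x (f x ^+ 2)%:E) `^ 2^-1)%E.
Proof.
rewrite /normL2 unlock; congr (_ `^ _)%E; apply: eq_integral => x _ /=.
by rewrite powR_mulrn// -normrX ger0_norm// sqr_ge0.
Qed.

Lemma sqint_ge0 f : (0 <= \int[leb]_x (f x ^+ 2)%:E)%E.
Proof. by apply: integral_ge0 => x _; rewrite lee_fin sqr_ge0. Qed.

Lemma L2P f : L2 f <->
  measurable_fun setT f /\ (\int[leb]_x (f x ^+ 2)%:E < +oo)%E.
Proof.
split=> [fL2|[mf fi]].
  split; first by move: fL2; rewrite /L2/= inE => /andP[]; rewrite inE.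
  have /integrable_lty := Lfun2_integrable_sqr fL2; exact.
rewrite /L2/= inE; apply/andP; split; rewrite inE//=.
by rewrite /finite_norm -/(normL2 f) normL2E poweR_lty.
Qed.

Lemma measurable_L2 f : L2 f -> measurable_fun setT f.
Proof. by move=> /L2P[]. Qed.

Lemma integ_sqr_L2 f : L2 f -> leb.-integrable setT (fun x => (f x ^+ 2)%:E).
Proof. exact: Lfun2_integrable_sqr. Qed.

Lemma L1P f : L1 f <-> leb.-integrable setT (EFin \o f).
Proof. exact: Lfun1_integrable. Qed.

Lemma L2D f g : L2 f -> L2 g -> L2 (fun x => f x + g x).
Proof.
rewrite /L2/= => hf hg.
by have [_] := Lfun_addr_closed leb (lee1n 2); exact.
Qed.

Lemma L2N f : L2 f -> L2 (fun x => - f x).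
Proof.
rewrite /L2/= => hf.
by have := @Lfun_oppr_closed _ _ _ leb _ f hf.
Qed.

Lemma L2B f g : L2 f -> L2 g -> L2 (fun x => f x - g x).
Proof. by move=> hf hg; exact: L2D (L2N hg). Qed.

Lemma L2Z a f : L2 f -> L2 (fun x => a * f x).
Proof.
move=> /L2P[mf fi]; apply/L2P; split; first exact: measurable_funM.
under eq_integral do rewrite exprMn EFinM.
rewrite ge0_integralZl//=.
- by rewrite lte_mul_pinfty// ?lee_fin ?sqr_ge0.
- by apply/measurable_EFinP; exact: measurable_funX.
- by move=> x _; rewrite lee_fin sqr_ge0.
- by rewrite lee_fin sqr_ge0.
Qed.

Lemma L2_le f g : measurable_fun setT f -> L2 g ->
  (forall x, `|f x| <= `|g x|) -> L2 f.
Proof.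
move=> mf /L2P[mg gi] fg; apply/L2P; split => //.
apply: le_lt_trans gi; apply: ge0_le_integral => //.
- by move=> x _; rewrite lee_fin sqr_ge0.
- by apply/measurable_EFinP; exact: measurable_funX.
- by apply/measurable_EFinP; exact: measurable_funX.
- move=> x _; rewrite lee_fin -(real_normK (num_real (f x))).
  by rewrite -(real_normK (num_real (g x))) lerXn2r ?nnegrE.
Qed.

Lemma L2_fin f : L2 f -> normL2 f = (nrm f)%:E.
Proof.
move=> fL2; rewrite /nrm fineK// ge0_fin_numE ?Lnorm_ge0//.
by move: fL2; rewrite /L2/= inE => /andP[_]; rewrite inE.
Qed.

Lemma nrm_ge0 f : 0 <= nrm f.
Proof. by rewrite /nrm fine_ge0 ?Lnorm_ge0. Qed.

Lemma nrm_sqr f : L2 f -> ((nrm f ^+ 2)%:E = \int[leb]_x (f x ^+ 2)%:E)%E.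
Proof.
move=> fL2; have := congr1 (fun t => (t `^ 2)%E) (normL2E f).
rewrite L2_fin// -poweRrM mulVf// poweRe1 ?sqint_ge0//= => <-.
by rewrite powR_mulrn// nrm_ge0.
Qed.

Lemma nrm_le f (a : R) : 0 <= a -> L2 f ->
  (\int[leb]_x (f x ^+ 2)%:E <= (a ^+ 2)%:E)%E -> nrm f <= a.
Proof.
move=> a0 fL2; rewrite -nrm_sqr// lee_fin.
by rewrite ler_pXn2r// nnegrE nrm_ge0.
Qed.

Lemma nrm_triangle f g : L2 f -> L2 g ->
  nrm (fun x => f x + g x) <= nrm f + nrm g.
Proof.
move=> fL gL; rewrite -lee_fin EFinD -!L2_fin//; last exact: L2D.
have mf := measurable_L2 fL; have mg := measurable_L2 gL.
exact: (@eminkowski _ _ R leb f g 2%:E mf mg (lee1n 2)).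
Qed.

Lemma nrm_dist f g h : L2 f -> L2 g -> L2 h ->
  nrm (fun x => f x - h x) <= nrm (fun x => f x - g x) + nrm (fun x => g x - h x).
Proof.
move=> fL gL hL; have := nrm_triangle (L2B fL gL) (L2B gL hL).
rewrite (_ : (fun x => _ + _) = (fun x => f x - h x))//.
by apply/funext => x; rewrite addrA subrK.
Qed.

Lemma normL2_distC f g : normL2 (fun x => f x - g x) = normL2 (fun x => g x - f x).
Proof.
by rewrite !normL2E; congr (_ `^ _)%E; apply: eq_integral => x _;
   rewrite -sqrrN opprB.
Qed.

Lemma nrm_distC f g : nrm (fun x => f x - g x) = nrm (fun x => g x - f x).
Proof. by rewrite /nrm normL2_distC. Qed.

Lemma ae_eq_nrm f g : measurable_fun setT f -> measurable_fun setT g ->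
  {ae leb, forall x, f x = g x} -> nrm f = nrm g.
Proof.
move=> mf mg fg; rewrite /nrm !normL2E; congr (fine (_ `^ _)%E).
apply: ae_eq_integral => //.
- by apply/measurable_EFinP; exact: measurable_funX.
- by apply/measurable_EFinP; exact: measurable_funX.
- by apply: aeS fg => x /= ->.
Qed.

Lemma nrm_eq0_ae_eq0 f : L2 f -> nrm f = 0 -> {ae leb, forall x, f x = 0}.
Proof.
move=> fL f0; have mf := measurable_L2 fL.
have f00 : Lnorm leb 2%:E (EFin \o f) = 0%E by rewrite -/(normL2 f) L2_fin// f0.
have mf' : measurable_fun setT (EFin \o f) by exact/measurable_EFinP.
have l2 : (0 < 2%:E :> \bar R)%E by rewrite lte_fin.
have [A [mA A0 fA]] := @Lnorm_eq0_eq0 _ _ R leb (EFin \o f) 2%:E mf' l2 f00.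
exists A; split => // x /= fx0; apply: fA => /= /(_ I)[].
exact: fx0.
Qed.

Lemma nrm_eq0_ae_eq f g : L2 f -> L2 g -> nrm (fun x => f x - g x) = 0 ->
  {ae leb, forall x, f x = g x}.
Proof.
move=> fL gL /(nrm_eq0_ae_eq0 (L2B fL gL)); apply: aeS => x /eqP.
by rewrite subr_eq0 => /eqP.
Qed.

End L2.
(* Unification would otherwise try to identify two functions of [L2] by unfolding
   their norms to Lebesgue integrals. *)
#[local] Opaque L2 nrm.

(** * Completeness *)

Section Completeness.
Variable R : realType.
Local Notation leb := (@lebesgue_measure R).
Implicit Types f g h : R -> R.

(** Fatou's lemma for the quadratic norm: it turns almost everywhere limits into
    members of [L2], and is used both for completeness and for removing the
    damping factor from the Hartley integral. *)
Lemma L2_fatou (h : nat -> R -> R) f (c : R) :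
  measurable_fun setT f -> (forall k, L2 (h k)) ->
  {ae leb, forall x, h k x @[k --> \oo] --> f x} ->
  0 <= c -> (forall k, nrm (h k) <= c) -> L2 f /\ nrm f <= c.
Proof.
move=> mf hL hf c0 hc.
have mh k : measurable_fun setT (h k) by exact: measurable_L2.
suff fc : (\int[leb]_x (f x ^+ 2)%:E <= (c ^+ 2)%:E)%E.
  have fL : L2 f by apply/L2P; split => //; apply: le_lt_trans fc (ltry _).
  by split => //; exact: nrm_le.
have -> : (\int[leb]_x (f x ^+ 2)%:E =
    \int[leb]_x limn_einf (fun k => (h k x ^+ 2)%:E))%E.
  apply: ae_eq_integral => //.
  - by apply/measurable_EFinP; exact: measurable_funX.
  - rewrite (_ : (fun x => limn_einf _) =
      (fun x => - limn_esup (fun k => (- (h k x ^+ 2))%:E))%E)//.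
    apply: measurableT_comp => //; apply: measurable_fun_limn_esup => k.
    by apply/measurable_EFinP; exact: (measurable_funN (measurable_funX 2 (mh k))).
  - apply: aeS hf => x hx _ /=.
    have hx2 : (h k x ^+ 2)%:E @[k --> \oo] --> (f x ^+ 2)%:E.
      apply: cvg_EFin; first exact: nearW.
      exact: (cvg_comp _ _ hx (@exprn_continuous R 2%N (f x))).
    rewrite is_cvg_limn_einfE; last by apply/cvg_ex; exists (f x ^+ 2)%:E.
    by apply/esym/cvg_lim.
apply: le_trans.
  apply: fatou => //.
  - by move=> k; apply/measurable_EFinP; exact: (measurable_funX 2 (mh k)).
  - by move=> k x _; rewrite lee_fin sqr_ge0.
rewrite limn_einf_lim; apply: lime_le; first exact: is_cvg_einfs.
near=> n; apply: (@le_trans _ _ (\int[leb]_x (h n x ^+ 2)%:E)%E).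
  by apply: ereal_inf_lbound; exists n => /=.
by rewrite -nrm_sqr// lee_fin lerXn2r// nnegrE ?nrm_ge0.
Unshelve. all: by end_near. Qed.

(** A quadratic majorant of the absolute value; with [t = 2 ^ k] it makes a series
    absolutely convergent as soon as its squares, weighted by [2 ^ k], are
    summable. *)
Lemma abs_le_weighted_sqr (t y : R) : 0 < t -> `|y| <= t^-1 + t * y ^+ 2.
Proof.
move=> t0; rewrite -(real_normK (num_real y)); set z := `|y|.
have z0 : 0 <= z by exact: normr_ge0.
have -> : t^-1 + t * z ^+ 2 = (1 + (t * z) ^+ 2) / t.
  by field; rewrite gt_eqF.
rewrite ler_pdivlMr//; nra.
Qed.

(** If the increments [d k] have norm at most [2 ^ (- k)], then
    [\sum_k 2 ^ k * d k ^ 2] has a finite integral, hence is finite almost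
    everywhere, and there [\sum_k `|d k|] converges by [abs_le_weighted_sqr].
    Working with squares avoids the norm of an infinite sum. *)
Lemma L2_fast_complete (h : nat -> R -> R) :
  (forall k, L2 (h k)) ->
  (forall k, nrm (fun x => h k.+1 x - h k x) <= (2^-1) ^+ k) ->
  exists f, measurable_fun setT f /\
    {ae leb, forall x, h k x @[k --> \oo] --> f x}.
Proof.
move=> hL hfast.
pose d k x := h k.+1 x - h k x.
have dL k : L2 (d k) by apply: L2B.
pose S x : \bar R := (\sum_(0 <= k <oo) (2 ^+ k * d k x ^+ 2)%:E)%E.
have mS k : measurable_fun setT (fun x => (2 ^+ k * d k x ^+ 2)%:E).
  apply/measurable_EFinP; apply: measurable_funM => //.
  by apply: measurable_funX; exact: measurable_L2.
have S0 k x : (0 <= (2 ^+ k * d k x ^+ 2)%:E)%E.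
  by rewrite lee_fin mulr_ge0 ?sqr_ge0 ?exprn_ge0.
have Sint : (\int[leb]_x S x < +oo)%E.
  rewrite /S integral_nneseries//.
  apply: (@le_lt_trans _ _ (\sum_(0 <= k <oo) (2 / 2 ^+ k.+1)%:E)%E); last first.
    have -> : (\sum_(0 <= k <oo) (2 / 2 ^+ k.+1)%:E = (2 : R)%:E)%E.
      have := @cvg_geometric_eseries_half R 2 0.
      rewrite expr0 divr1 => /cvg_lim => <- //.
      by congr (limn _); apply/funext => n; apply: eq_bigr => k _; rewrite addn1 natrX.
    by rewrite ltry.
  apply: lee_nneseries => k; [by move=> _ _; apply: integral_ge0 => x _|move=> _].
  under eq_integral do rewrite EFinM.
  rewrite ge0_integralZl_EFin//; first last.
  - by apply/measurable_EFinP; apply: measurable_funX; exact: measurable_L2.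
  - by move=> x _; rewrite lee_fin sqr_ge0.
  rewrite -nrm_sqr// -EFinM lee_fin (_ : 2 / 2 ^+ k.+1 = (2 ^+ k)^-1 :> R); last first.
    by rewrite exprS invfM mulrA divff// mul1r.
  apply: (@le_trans _ _ (2 ^+ k * ((2^-1) ^+ k) ^+ 2)).
    apply: ler_wpM2l; first exact: exprn_ge0.
    by apply: lerXn2r; rewrite ?nnegrE ?nrm_ge0 ?exprn_ge0 ?invr_ge0 ?hfast.
  by rewrite expr2 mulrA -exprMn divff// expr1n !mul1r exprVn.
have mSS : measurable_fun setT S by exact: ge0_emeasurable_sum.
have Sfin : {ae leb, forall x, S x \is a fin_num}.
  have Si : leb.-integrable setT S.
    apply/integrableP; split => //.
    apply: le_lt_trans Sint; apply: ge0_le_integral => //.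
    - exact: measurableT_comp.
    - by move=> x _; rewrite gee0_abs//; exact: nneseries_ge0.
  by have := integrable_ae measurableT Si; apply: aeS => x; exact.
(* The upper limit is measurable and equals the limit where it exists. *)
pose f x := fine (limn_esup (fun k => (h k x)%:E)).
exists f; split.
  apply: (measurableT_comp (@fine_measurable R setT measurableT)).
  by apply: measurable_fun_limn_esup => k; apply/measurable_EFinP; exact: measurable_L2.
apply: aeS Sfin => x Sx.
suff /cvg_ex[l hl] : cvgn (fun k => h k x).
  rewrite /f is_cvg_limn_esupE; last first.
    by apply/cvg_ex; exists l%:E; apply: cvg_EFin => //; exact: nearW.
  have -> : limn (fun k => (h k x)%:E) = l%:E.
    by apply/cvg_lim => //; apply: cvg_EFin => //; exact: nearW.
  exact: hl.
have hE k : h k x = h 0%N x + series (d ^~ x) k.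
  by rewrite (eq_sum_telescope (fun k => h k x)).
suff dc : cvgn (series (d ^~ x)).
  rewrite (_ : (fun k => _) = (fun k => h 0%N x + series (d ^~ x) k)); last exact/funext.
  by apply: is_cvgD => //; exact: is_cvg_cst.
apply: normed_cvg; apply: nondecreasing_is_cvgn.
  by move=> m n mn; apply: (@nondecreasing_series _ (fun k => `|d k x|) xpredT 0).
exists (2 + fine (S x)) => _ [n _ <-]; rewrite /normed_series_of /series/=.
apply: (@le_trans _ _ (\sum_(0 <= k < n) ((2^-1) ^+ k + 2 ^+ k * d k x ^+ 2))).
  apply: ler_sum => k _; rewrite exprVn; apply: abs_le_weighted_sqr.
  by rewrite exprn_gt0.
rewrite big_split/= lerD//.
  have := @geometric_le_lim R n 1 (2^-1); rewrite /series/= => /(_ ler01).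
  rewrite ger0_norm//.
  under eq_bigr do rewrite mul1r.
  move=> H; apply: le_trans; first apply: H; rewrite ?invr_gt0 ?invf_lt1 ?ltr1n//.
  by rewrite (_ : 1 - 2^-1 = 2^-1 :> R) ?invrK ?mul1r//; lra.
rewrite -lee_fin fineK// -sumEFin; exact: nneseries_lim_ge.
Qed.

(** The theorem of Riesz and Fischer: a fast subsequence converges almost
    everywhere, and [L2_fatou] compares the whole sequence with its limit. *)
Lemma L2_complete (g : nat -> R -> R) :
  (forall k, L2 (g k)) ->
  (forall e, 0 < e -> exists N, forall m n, (N <= m)%N -> (N <= n)%N ->
     nrm (fun x => g m x - g n x) <= e) ->
  exists2 f, L2 f & nrm (fun x => g n x - f x) @[n --> \oo] --> (0 : R).
Proof.
move=> gL gC.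
have /choice[N NP] : forall k : nat, exists N, forall m n, (N <= m)%N ->
    (N <= n)%N -> nrm (fun x => g m x - g n x) <= (2^-1) ^+ k.
  by move=> k; apply: gC; rewrite exprn_gt0.
(* Summing makes the sequence of ranks nondecreasing and above [N]. *)
pose phi k := (\sum_(0 <= i < k.+1) N i)%N.
have phiN k : (N k <= phi k)%N by rewrite /phi big_nat_recr//= leq_addl.
have phiS k : (phi k <= phi k.+1)%N by rewrite /phi [leqRHS]big_nat_recr//= leq_addr.
have phi_mono k j : (phi k <= phi (k + j))%N.
  by elim: j => [|j IH]; rewrite ?addn0// addnS (leq_trans IH).
have [||f [mf hf]] := @L2_fast_complete (fun k => g (phi k)).
- by move=> k; exact: gL.
- by move=> k; apply: NP => //; apply: leq_trans (phiS k).
have key k n : (N k <= n)%N ->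
    L2 (fun x => g n x - f x) /\ nrm (fun x => g n x - f x) <= (2^-1) ^+ k.
  move=> kn; apply: (@L2_fatou (fun j x => g n x - g (phi (k + j)%N) x)).
  - by apply: measurable_funB => //; exact: measurable_L2.
  - by move=> j; exact: L2B.
  - apply: aeS hf => x hx; apply: cvgB; first exact: cvg_cst.
    have := hx; rewrite -(@cvg_shiftn k _ (fun j => g (phi j) x)).
    by under eq_fun do rewrite addnC.
  - by rewrite exprn_ge0.
  - by move=> j; apply: NP => //; apply: leq_trans (phi_mono _ _).
exists f.
  have [fL _] := key 0%N (N 0%N) (leqnn _).
  have := L2B (gL (N 0%N)) fL.
  by rewrite (_ : (fun x => _ - _) = f)//; apply/funext => x; rewrite subKr.
apply/cvgrPdist_le => e e0.
have : (2^-1 : R) ^+ k @[k --> \oo] --> (0:R).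
  by apply: cvg_expr; rewrite ger0_norm// invf_lt1// ltr1n.
move=> /cvgrPdist_le /(_ _ e0)[k _ /(_ k (leqnn k))]/=.
rewrite sub0r normrN ger0_norm ?exprn_ge0// => ke.
exists (N k) => // n /= /key[_ nk].
by rewrite sub0r normrN ger0_norm ?nrm_ge0// (le_trans nk).
Qed.

End Completeness.

(** * The cas function and its Abel means *)

Section Kernel.
Variable R : realType.
Local Notation leb := (@lebesgue_measure R).
Implicit Types e a c t x y : R.

Definition cas t : R := cos t + sin t.
Definition abel e t : R := expR (- (e * `|t|)).
(** The harmonic extension of the Dirac mass to height [e / (2 pi)]; this is the
    transform of [abel e]. *)
Definition poisson e x : R := 2 * e / (e ^+ 2 + (2 * pi * x) ^+ 2).

Lemma is_derive_lin a t : is_derive t 1 (fun t => a * t) a.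
Proof.
by apply: is_derive_eq; rewrite /= -[RHS]mulr1.
Qed.

Lemma denom_gt0 e a : 0 < e -> 0 < e ^+ 2 + a ^+ 2.
Proof. by move=> e0; rewrite ltr_wpDr ?sqr_ge0// exprn_gt0. Qed.

Let primitive e a c t : R :=
  expR (- e * t) * ((- e * cos (a * t) + a * sin (a * t)) / (e ^+ 2 + a ^+ 2) - c / e).

Lemma is_derive_prim e a c t : 0 < e ->
  is_derive t 1 (primitive e a c) (expR (- e * t) * (c + cos (a * t))).
Proof.
move=> e0.
have Da := is_derive_lin a t.
have De := is_derive_lin (- e) t.
have D1 : is_derive t 1 (fun t => expR (- e * t)) (- e * expR (- e * t)).
  apply: (is_derive_eq (@is_derive1_comp R expR (fun t => - e * t) t _ _ _ De)).
  by rewrite mulrC.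
have D2 : is_derive t 1 (fun t => cos (a * t)) (a * - sin (a * t)).
  apply: (is_derive_eq (@is_derive1_comp R cos (fun t => a * t) t _ _ _ Da)).
  by rewrite mulrC.
have D3 : is_derive t 1 (fun t => sin (a * t)) (a * cos (a * t)).
  apply: (is_derive_eq (@is_derive1_comp R sin (fun t => a * t) t _ _ _ Da)).
  by rewrite mulrC.
rewrite /primitive.
apply: is_derive_eq => /=.
rewrite /GRing.scale/=; by field; rewrite !gt_eqF ?denom_gt0.
Qed.

Lemma cvg_prim e a c : 0 < e -> primitive e a c t @[t --> +oo] --> 0.
Proof.
move=> e0; apply: norm_cvg0.
pose M := (e + `|a|) / (e ^+ 2 + a ^+ 2) + `|c / e|.
have d0 := denom_gt0 a e0.
have ub t : `|primitive e a c t| <= expR (- (e * t)) * M.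
  rewrite /primitive normrM mulNr ger0_norm ?expR_ge0// ler_wpM2l ?expR_ge0//.
  rewrite (le_trans (ler_normB _ _))// lerD// normrM normfV (gtr0_norm d0).
  apply: ler_wpM2r; first by rewrite invr_ge0 ltW.
  apply: (le_trans (ler_normD _ _)); apply: lerD.
    by rewrite normrM normrN (gtr0_norm e0) ler_piMr ?cos_max// ltW.
  by rewrite normrM ler_piMr// sin_max.
apply: (@squeeze_cvgr _ _ _ _ (fun=> 0) (fun t => expR (- (e * t)) * M)).
- by apply: nearW => t; rewrite normr_ge0 ub.
- exact: cvg_cst.
rewrite -[X in _ --> X](mul0r M); apply: cvgMl.
apply: (@cvg_comp _ _ _ (fun t => e * t) (fun t => expR (- t))); last exact: cvgr_expR.
apply: gt0_cvgMry => //.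
Qed.

Lemma continuous_scal a : continuous (fun t : R => a * t).
Proof. by move=> t; apply: cvgM; [exact: cvg_cst|exact: cvg_id]. Qed.

Lemma continuous_expcos e a c :
  continuous (fun t => expR (- e * t) * (c + cos (a * t))).
Proof.
move=> t; apply: cvgM.
  exact: (continuous_comp (@continuous_scal (- e) t) (@continuous_expR R _)).
apply: cvgD; first exact: cvg_cst.
exact: (continuous_comp (@continuous_scal a t) (@continuous_cos R _)).
Qed.

(** The constant [c] makes the integrand nonnegative, so that the fundamental
    theorem on a half-line for nonnegative functions applies. *)
Lemma integral_expcos e a c : 0 < e -> 1 <= c ->
  (\int[leb]_(t in `[0%R, +oo[) (expR (- e * t) * (c + cos (a * t)))%:E =
   (c / e + e / (e ^+ 2 + a ^+ 2))%:E)%E.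
Proof.
move=> e0 c1.
have D t := is_derive_prim a c t e0.
rewrite (@ge0_continuous_FTC2y R _ (primitive e a c) 0 0).
- rewrite -EFinB /primitive !mulr0 expR0 cos0 sin0; congr EFin.
  by field; rewrite !gt_eqF ?denom_gt0.
- move=> t _; rewrite mulr_ge0 ?expR_ge0//.
  by have := cos_max (a * t); rewrite ler_norml => /andP[+ _]; lra.
- by apply: continuous_subspaceT; exact: continuous_expcos.
- exact: cvg_prim.
- by move=> t _; have [] := D t.
- apply: cvg_at_right_filter; apply: differentiable_continuous.
  by apply/derivable1_diffP; have [] := D 0.
- by move=> t _; rewrite derive1E; have [_ ->] := D t.
Qed.

Lemma abel_ge0 e t : 0 <= abel e t. Proof. exact: expR_ge0. Qed.

Lemma abelN e t : abel e (- t) = abel e t.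
Proof. by rewrite /abel normrN. Qed.

Lemma continuous_abel e : continuous (abel e).
Proof.
move=> t; apply: (@continuous_comp _ _ _ (fun t => - (e * `|t|)) expR);
  last exact: continuous_expR.
apply: cvgN; apply: cvgM; first exact: cvg_cst.
exact: norm_continuous.
Qed.

Lemma measurable_abel e : measurable_fun setT (abel e).
Proof. by apply: continuous_measurable_fun; exact: continuous_abel. Qed.

Lemma continuous_cos_scal a : continuous (fun t => cos (a * t)).
Proof.
by move=> t; exact: (continuous_comp (@continuous_scal a t) (@continuous_cos R _)).
Qed.

Lemma continuous_cas a : continuous (fun t => cas (a * t)).
Proof.
move=> t; apply: cvgD; first exact: continuous_cos_scal.
exact: (continuous_comp (@continuous_scal a t) (@continuous_sin R _)).
Qed.

Lemma integral_abel_cos e a c : 0 < e -> 1 <= c ->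
  (\int[leb]_t (abel e t * (c + cos (a * t)))%:E =
   (2 * (c / e + e / (e ^+ 2 + a ^+ 2)))%:E)%E.
Proof.
move=> e0 c1; rewrite ge0_symfun_integralT.
- rewrite -set_itvcy EFinM -(integral_expcos a e0 c1); congr (_ * _)%E.
  apply: eq_integral => t; rewrite inE/= in_itv/= andbT => t0.
  by rewrite /abel ger0_norm// mulNr.
- move=> t; rewrite mulr_ge0 ?abel_ge0//.
  by have := cos_max (a * t); rewrite ler_norml => /andP[+ _]; lra.
- move=> t; apply: cvgM; first exact: continuous_abel.
  by apply: cvgD; [exact: cvg_cst|exact: continuous_cos_scal].
- by move=> t /=; rewrite abelN mulrN cosN.
Qed.

Lemma integral_abel e : 0 < e -> (\int[leb]_t (abel e t)%:E = (2 / e)%:E)%E.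
Proof.
move=> e0; have := integral_abel_cos 0 e0 (lexx 1).
under eq_integral do rewrite mul0r cos0 mulrC EFinM.
rewrite ge0_integralZl_EFin//; last first.
- by apply/measurable_EFinP; exact: (measurable_abel e).
- by move=> t _; rewrite lee_fin abel_ge0.
rewrite (_ : 2 * (1 / e + e / (e ^+ 2 + 0 ^+ 2)) = (1 + 1) * (2 / e)); last first.
  by field; rewrite gt_eqF.
rewrite EFinM.
move=> h; have : ((1 + 1 : R)^-1%:E * ((1 + 1)%:E * \int[leb]_t (abel e t)%:E) =
    (1 + 1 : R)^-1%:E * ((1 + 1)%:E * (2 * e^-1)%:E))%E.
  by rewrite h.
by rewrite !muleA -!EFinM mulVf ?gt_eqF// mul1r mul1e.
Qed.

Lemma integ_abel e : 0 < e -> leb.-integrable setT (EFin \o abel e).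
Proof.
move=> e0; apply/integrableP; split.
  by apply/measurable_EFinP; exact: (measurable_abel e).
under eq_integral do rewrite /= ger0_norm ?abel_ge0//.
by rewrite integral_abel// ltry.
Qed.

Lemma cas_bound t : `|cas t| <= 2.
Proof.
by rewrite (le_trans (ler_normD _ _))// -[leRHS]/(1 + 1) lerD ?cos_max ?sin_max.
Qed.

Lemma ge0_integral_reflect (f : R -> \bar R) : measurable_fun setT f ->
  (forall t, 0 <= f t)%E ->
  (\int[leb]_t f (- t)%R = \int[leb]_t f t)%E.
Proof.
move=> mf f0.
transitivity (\int[pushforward leb (-%R : _ -> measurableTypeR R)]_t f t)%E.
  by rewrite ge0_integral_pushforward.
by apply: eq_measure_integral => A mA _; exact: lebesgue_measureN.
Qed.


Lemma measurable_cas a : measurable_fun setT (fun t => cas (a * t)).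
Proof. by apply: continuous_measurable_fun; exact: continuous_cas. Qed.

Lemma cas_mul_even u v : cas u * cas v + cas (- u) * cas (- v) = 2 * cos (u - v).
Proof. by rewrite /cas !cosN !sinN cosB; ring. Qed.

(** Averaging the integrand with its reflection replaces the product of the two
    kernels by [cos ((a - b) * t)], by [cas_mul_even]. *)
Lemma integral_abel_cas_cas e a b : 0 < e ->
  \int[leb]_t (abel e t * (cas (a * t) * cas (b * t))) =
  2 * e / (e ^+ 2 + (a - b) ^+ 2).
Proof.
move=> e0.
(* [4] bounds the product of the two kernels, so [G] is nonnegative. *)
pose G t := abel e t * (4 + cas (a * t) * cas (b * t)).
have mG : measurable_fun setT G.
  apply: measurable_funM; first exact: measurable_abel.
  apply: measurable_funD; first exact: measurable_cst.
  by apply: measurable_funM; exact: measurable_cas.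
have mGE : measurable_fun setT (EFin \o G) by exact/measurable_EFinP.
have G0 t : 0 <= G t.
  rewrite mulr_ge0 ?abel_ge0// -lerBlDl sub0r.
  have : `|cas (a * t) * cas (b * t)| <= 2 * 2.
    by rewrite normrM ler_pM ?cas_bound.
  by rewrite ler_norml => /andP[+ _]; lra.
have GI : (\int[leb]_t (G t)%:E = (2 * (4 / e + e / (e ^+ 2 + (a - b) ^+ 2)))%:E)%E.
  have l4 : 1 <= 4 :> R by rewrite ler1n.
  have := integral_abel_cos (a - b) e0 l4.
  have -> : (\int[leb]_t (abel e t * (4 + cos ((a - b) * t)))%:E =
             \int[leb]_t (2^-1%:E * ((G t)%:E + (G (- t))%:E)))%E.
    apply: eq_integral => t _; rewrite -EFinD -EFinM /G abelN -mulrDr !mulrN.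
    by rewrite addrACA cas_mul_even mulrBl; congr EFin; lra.
  rewrite ge0_integralZl_EFin//; first last.
  - apply: emeasurable_funD => //.
    by apply: (measurableT_comp mGE); exact: oppr_measurable.
  - by move=> t _; rewrite adde_ge0// lee_fin.
  rewrite ge0_integralD//; first last.
  - by apply: (measurableT_comp mGE); exact: oppr_measurable.
  - by move=> t _; rewrite lee_fin.
  - by move=> t _; rewrite lee_fin.
  rewrite (ge0_integral_reflect mGE); last by move=> t; rewrite lee_fin.
  by move=> <-; rewrite -mule2n -mule_natl muleA -EFinM mulVf ?mul1e// pnatr_eq0.
have iG : leb.-integrable setT (EFin \o G).
  apply/integrableP; split => //.
  under eq_integral do rewrite /= ger0_norm//.
  by rewrite GI ltry.
have iA : leb.-integrable setT (EFin \o (fun t => 4 * abel e t)).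
  by have := integrableZl measurableT 4 (integ_abel e0); apply: eq_integrable.
transitivity (\int[leb]_t (G t - 4 * abel e t)).
  by apply: eq_Rintegral => t _; rewrite /G; ring.
rewrite RintegralB// RintegralZl//; last exact: integ_abel.
by rewrite /Rintegral GI integral_abel//=; field; rewrite !gt_eqF ?denom_gt0.
Qed.

End Kernel.

(** * The Hartley integral of integrable functions *)

Section Hartley.
Variable R : realType.
Local Notation leb := (@lebesgue_measure R).
Local Notation integ f := (leb.-integrable setT (EFin \o f)).
Implicit Types f g h : R -> R.

Definition hart f xi : R := \int[leb]_x (f x * cas (2 * pi * x * xi)).

Lemma measurable_cas1 : measurable_fun setT (@cas R).
Proof.
rewrite (_ : @cas R = fun t => cas (1 * t)); first exact: measurable_cas.
by apply/funext => t; rewrite mul1r.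
Qed.

Lemma integ_measurable f : integ f -> measurable_fun setT f.
Proof. by move=> /measurable_int /measurable_EFinP. Qed.

Lemma integ_mul_bounded f g (c : R) : integ f -> measurable_fun setT g ->
  (forall x, `|g x| <= c) -> integ (fun x => f x * g x).
Proof.
move=> fi mg gc; have mf := integ_measurable fi.
have ci : leb.-integrable setT (fun x => (c%:E * (EFin \o f) x)%E).
  exact: integrableZl.
apply: le_integrable ci => //.
  by apply/measurable_EFinP; exact: (measurable_funM mf mg).
move=> x _ /=; rewrite lee_fin normrM mulrC normrM ler_wpM2r//.
by rewrite (le_trans (gc x))// ler_norm.
Qed.

Lemma measurable_cas_kernel xi : measurable_fun setT (fun x : R => cas (2 * pi * x * xi)).
Proof.
rewrite (_ : (fun x => _) = fun x => cas ((2 * pi * xi) * x)); first exact: measurable_cas.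
by apply/funext => x; rewrite mulrAC.
Qed.

Lemma integ_hart f xi : integ f -> integ (fun x => f x * cas (2 * pi * x * xi)).
Proof.
move=> fi; apply: (integ_mul_bounded fi); first exact: measurable_cas_kernel.
by move=> x; exact: cas_bound.
Qed.

Lemma hart_bound f xi : integ f -> `|hart f xi| <= 2 * \int[leb]_x `|f x|.
Proof.
move=> fi; have nfi : integ (fun x => `|f x|) by exact: integrable_norm.
rewrite (le_trans (le_normr_Rintegral _ _))//; first exact: integ_hart.
rewrite -RintegralZl//; apply: le_Rintegral => //.
- by apply: integrable_norm; exact: integ_hart.
- by have := integrableZl measurableT 2 nfi.
- by move=> x _; rewrite normrM mulrC ler_wpM2r// cas_bound.
Qed.

Lemma continuous_hart f : integ f -> continuous (hart f).
Proof.
move=> fi xi.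
have nfi : integ (fun x => `|f x|) by exact: integrable_norm.
apply: (@continuity_under_integral R _ _ leb
  (fun xi x => f x * cas (2 * pi * x * xi)) setT measurableT (xi - 1) (xi + 1)
  _ _ (fun x => 2 * `|f x|)).
- by move=> y _; exact: integ_hart.
- apply: nearW => x _ y _; apply: cvgM; first exact: cvg_cst.
  exact: continuous_cas.
- by have := integrableZl measurableT 2 nfi.
- by move=> y _; apply: nearW => x _; rewrite normrM mulrC ler_wpM2r// cas_bound.
- by rewrite inE/= in_itv/=; lra.
Qed.

Lemma measurable_hart f : integ f -> measurable_fun setT (hart f).
Proof. by move=> fi; apply: continuous_measurable_fun; exact: continuous_hart. Qed.

Lemma hartB f g xi : integ f -> integ g ->
  hart (fun x => f x - g x) xi = hart f xi - hart g xi.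
Proof.
move=> fi gi; rewrite /hart -RintegralB//; try exact: integ_hart.
by apply: eq_Rintegral => x _; rewrite mulrBl.
Qed.

Lemma measurable_hart_kernel f g : measurable_fun setT f -> measurable_fun setT g ->
  measurable_fun [set: measurableTypeR R * measurableTypeR R]
    (fun z : R * R => (f z.1 * cas (2 * pi * z.1 * z.2) * g z.2)%:E).
Proof.
move=> mf mg; apply/measurable_EFinP.
have m1 : measurable_fun [set: measurableTypeR R * measurableTypeR R] (fun z : R * R => z.1).
  exact: measurable_fst.
have m2 : measurable_fun [set: measurableTypeR R * measurableTypeR R] (fun z : R * R => z.2).
  exact: measurable_snd.
apply: measurable_funM; first apply: measurable_funM.
- exact: (measurableT_comp mf m1).
- apply: (measurableT_comp measurable_cas1).
  by apply: measurable_funM => //; apply: measurable_funM.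
- exact: (measurableT_comp mg m2).
Qed.

Lemma integral_Rintegral f : integ f -> (\int[leb]_x (f x)%:E = (\int[leb]_x f x)%:E)%E.
Proof. by move=> fi; rewrite /Rintegral fineK//; exact: integrable_fin_num. Qed.

Lemma integrable_tensor f g : integ f -> integ g ->
  (leb \x leb)%E.-integrable setT (fun z : R * R => (f z.1 * g z.2)%:E).
Proof.
move=> fi gi; have mf := integ_measurable fi; have mg := integ_measurable gi.
have nfi : integ (fun x => `|f x|) by exact: integrable_norm.
have ngi : integ (fun x => `|g x|) by exact: integrable_norm.
apply/integrable12ltyP => /=.
  apply/measurable_EFinP; apply: measurable_funM.
  - exact: (measurableT_comp mf (@measurable_fst _ _ _ _)).
  - exact: (measurableT_comp mg (@measurable_snd _ _ _ _)).
rewrite (_ : (\int[leb]_x _)%E =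
    (\int[leb]_x ((\int[leb]_y `|g y|) * `|f x|)%:E)%E).
  by have /integrable_lty := integrableZl measurableT (\int[leb]_y `|g y|) nfi; exact.
apply: eq_integral => x _.
rewrite mulrC EFinM -(integral_Rintegral ngi) -ge0_integralZl_EFin//.
  by apply: eq_integral => y _; rewrite /= normrM EFinM.
by apply: (measurable_int leb).
Qed.

(** The kernel is symmetric in its two variables, so this is Fubini's theorem for
    [f x * cas (2 * pi * x * xi) * g xi]. *)
Lemma hart_multiplication f g : integ f -> integ g ->
  \int[leb]_xi (hart f xi * g xi) = \int[leb]_x (f x * hart g x).
Proof.
move=> fi gi; have mf := integ_measurable fi; have mg := integ_measurable gi.
pose F (z : R * R) := (f z.1 * cas (2 * pi * z.1 * z.2) * g z.2)%:E.
have mF : measurable_fun setT F := measurable_hart_kernel mf mg.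
have iF : (leb \x leb)%E.-integrable setT F.
  have i2 := integrableZl measurableT 2 (integrable_tensor fi gi).
  apply: le_integrable i2 => // -[x y] _ /=.
  rewrite lee_fin mulrAC normrM mulrC [leRHS]normrM ler_wpM2r//.
  by rewrite (le_trans (cas_bound _))// ler_norm.
have := Fubini iF; rewrite /F/=.
have -> : (\int[leb]_x \int[leb]_y (f x * cas (2 * pi * x * y) * g y)%:E =
   \int[leb]_x (f x * hart g x)%:E)%E.
  apply: eq_integral => x _.
  have gx : integ (fun y => g y * cas (2 * pi * y * x)) by exact: integ_hart.
  rewrite /hart -RintegralZl// -integral_Rintegral.
    by apply: eq_integral => y _; rewrite -mulrA (mulrC (cas _)) (mulrAC _ x y).
  by have := integrableZl measurableT (f x) gx; exact.
have -> : (\int[leb]_y \int[leb]_x (f x * cas (2 * pi * x * y) * g y)%:E =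
   \int[leb]_x (hart f x * g x)%:E)%E.
  apply: eq_integral => y _.
  have fy : integ (fun x => f x * cas (2 * pi * x * y)) by exact: integ_hart.
  rewrite /hart -RintegralZr// -integral_Rintegral//.
  have := integrableZr measurableT (g y) fy; exact.
by rewrite /Rintegral => ->.
Qed.


(** [hart] is made opaque below, lest unification compare two transforms by
    unfolding them to Lebesgue integrals; this equation is what remains of its
    definition. *)
Lemma hartE f xi : hart f xi = \int[leb]_x (f x * cas (2 * pi * x * xi)).
Proof. by []. Qed.

End Hartley.
#[local] Opaque hart.

(** * Abel summation and the Poisson kernel *)

Section Poisson.
Variable R : realType.
Local Notation leb := (@lebesgue_measure R).
Local Notation integ f := (leb.-integrable setT (EFin \o f)).
Implicit Types f g h : R -> R.
Implicit Types e x y a b : R.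

Lemma poisson_ge0 e x : 0 < e -> 0 <= poisson e x.
Proof.
by move=> e0; rewrite /poisson divr_ge0 ?mulr_ge0 ?(ltW e0)// ltW// denom_gt0.
Qed.

Lemma poissonN e x : poisson e (- x) = poisson e x.
Proof. by rewrite /poisson mulrN sqrrN. Qed.

Lemma poisson_distC e x y : poisson e (x - y) = poisson e (y - x).
Proof. by rewrite -poissonN opprB. Qed.

Lemma poisson_bound e x : 0 < e -> `|poisson e x| <= 2 / e.
Proof.
move=> e0; rewrite ger0_norm ?poisson_ge0// /poisson.
rewrite ler_pdivrMr ?denom_gt0// [leRHS]mulrAC ler_pdivlMr//.
by have := sqr_ge0 (2 * pi * x); nra.
Qed.

Let primitive e x y : R := pi^-1 * atan (2 * pi / e * (y - x)).

Lemma is_derive_poisson e x y : 0 < e ->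
  is_derive y 1 (primitive e x) (poisson e (y - x)).
Proof.
move=> e0.
have D1 : is_derive y 1 (fun y => 2 * pi / e * (y - x)) (2 * pi / e).
  have D0 : is_derive y 1 (fun y => y - x) 1.
    by apply: is_derive_eq; rewrite /= subr0.
  by apply: is_derive_eq; rewrite /= -[RHS]mulr1.
have := @is_derive1_comp R (@atan R) (fun y => 2 * pi / e * (y - x)) y _ _ _ D1.
move=> /(_ _ (is_derive1_atan _)) D2.
have -> : poisson e (y - x) = pi^-1 *: ((1 + (2 * pi / e * (y - x)) ^+ 2)^-1 * (2 * pi / e)).
  rewrite /GRing.scale/= /poisson.
  have p0 : pi != 0 :> R by rewrite gt_eqF ?pi_gt0.
  have h1 : e ^+ 2 + (2 * pi * (y - x)) ^+ 2 != 0 by rewrite gt_eqF ?denom_gt0.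
  have h2 : 1 + (2 * pi / e * (y - x)) ^+ 2 != 0.
    by rewrite gt_eqF// ltr_wpDr ?sqr_ge0.
  have -> : 1 + (2 * pi / e * (y - x)) ^+ 2 = (e ^+ 2 + (2 * pi * (y - x)) ^+ 2) / e ^+ 2.
    by move: (pi : R) => p; field; rewrite gt_eqF.
  by move: p0 h1; move: (pi : R) => p p0 h1; field; rewrite p0 h1 gt_eqF.
have := is_deriveZ pi^-1 D2; exact.
Qed.

Lemma continuous_poisson e x : 0 < e -> continuous (fun y => poisson e (y - x)).
Proof.
move=> e0 y; rewrite /poisson.
apply: cvgM; first exact: cvg_cst.
apply: cvgV; first by rewrite gt_eqF ?denom_gt0.
apply: cvgD; first exact: cvg_cst.
have H : 2 * pi * (y0 - x) @[y0 --> y] --> 2 * pi * (y - x).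
  apply: cvgM; first exact: cvg_cst.
  by apply: cvgB; [exact: cvg_id|exact: cvg_cst].
exact: (cvg_comp _ _ H (@exprn_continuous R 2%N _)).
Qed.

Lemma measurable_poisson e x : 0 < e ->
  measurable_fun setT (fun y => poisson e (y - x)).
Proof. by move=> e0; apply: continuous_measurable_fun; exact: continuous_poisson. Qed.

Lemma measurable_poisson0 e : 0 < e -> measurable_fun setT (poisson e).
Proof.
move=> e0; have := measurable_poisson 0 e0.
by under eq_fun do rewrite subr0.
Qed.

Lemma integral_poisson_itv e x a b : 0 < e -> a < b ->
  (\int[leb]_(y in `[a, b]) (poisson e (y - x))%:E =
   (pi^-1 * (atan (2 * pi / e * (b - x)) - atan (2 * pi / e * (a - x))))%:E)%E.
Proof.
move=> e0 ab.
have D y := is_derive_poisson x y e0.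
have C y : primitive e x z @[z --> y] --> primitive e x y.
  apply: differentiable_continuous.
  by apply/derivable1_diffP; have [] := D y.
rewrite (@continuous_FTC2 R _ (primitive e x) _ _ ab).
- by rewrite /primitive -EFinB -mulrBr.
- by apply: continuous_subspaceT; exact: continuous_poisson.
- split; first by move=> y _; have [] := D y.
  + exact/cvg_at_right_filter/C.
  + exact/cvg_at_left_filter/C.
- by move=> y _; rewrite derive1E; have [_ ->] := D y.
Qed.

(** Exhaust the line by intervals: over each of them the integral is a difference
    of two arctangents divided by [pi]. *)
Lemma integral_poisson_le1 e x : 0 < e ->
  (\int[leb]_y (poisson e (y - x))%:E <= 1)%E.
Proof.
move=> e0.
have mP := measurable_poisson x e0.
pose F i : set (measurableTypeR R) := `[- i.+1%:R, i.+1%:R]%classic.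
have FT : \bigcup_i F i = [set: R].
  apply/seteqP; split => // z _; exists (Num.truncn `|z|) => //=.
  by rewrite /F/= in_itv/= -ler_norml ltW// truncnS_gt.
have cvF : (\int[leb]_(y in F i) (poisson e (y - x))%:E @[i --> \oo] -->
            \int[leb]_(y in \bigcup_i F i) (poisson e (y - x))%:E)%E.
  apply: ge0_nondecreasing_set_cvg_integral.
  - apply/nondecreasing_seqP => n; rewrite subsetEset /F.
    by apply: subset_itv; rewrite bnd_simp ?lerN2 ler_nat.
  - by move=> i; exact: measurable_itv.
  - move=> i; apply: measurable_funTS; exact/measurable_EFinP.
  - by move=> i z _; rewrite lee_fin poisson_ge0.
rewrite -FT -(cvg_lim _ cvF)//; apply: lime_le; first by apply/cvg_ex; eexists; exact: cvF.
apply: nearW => n; rewrite integral_poisson_itv// ?lee_fin; last first.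
  by rewrite (@lt_trans _ _ 0) ?oppr_lt0 ?ltr0n.
rewrite mulrC ler_pdivrMr ?pi_gt0// mul1r.
set u := 2 * pi / e * _; set v := 2 * pi / e * _.
have := atan_ltpi2 u; have := atan_gtNpi2 v; lra.
Qed.

Definition abel_cas e y : R -> R := fun xi => abel e xi * cas (2 * pi * y * xi).

Lemma integ_abel_cas e y : 0 < e -> integ (abel_cas e y).
Proof.
move=> e0; apply: (integ_mul_bounded (integ_abel e0)).
  exact: measurable_cas.
by move=> x; exact: cas_bound.
Qed.

(** A damped kernel function is integrable, unlike the kernel itself; testing
    against it in [hart_multiplication] evaluates damped double transforms. *)
Lemma hart_abel_cas e x y : 0 < e -> hart (abel_cas e y) x = poisson e (y - x).
Proof.
move=> e0; rewrite hartE /abel_cas /poisson mulrBr -integral_abel_cas_cas//.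
by apply: eq_Rintegral => t _; rewrite -mulrA (mulrAC _ t x).
Qed.

Lemma integ_hart_abel f e : 0 < e -> integ f -> integ (fun xi => hart f xi * abel e xi).
Proof.
move=> e0 fi.
have := integ_mul_bounded (integ_abel e0) (measurable_hart fi) (fun x => hart_bound x fi).
by under eq_fun do rewrite mulrC.
Qed.

(** Abel summation of the inversion integral: damping the transform and
    transforming back convolves with the Poisson kernel. *)
Lemma hart_hart_abel f e y : 0 < e -> integ f ->
  hart (fun xi => hart f xi * abel e xi) y =
  \int[leb]_x (f x * poisson e (y - x)).
Proof.
move=> e0 fi.
under [RHS]eq_Rintegral do rewrite -hart_abel_cas//.
rewrite -hart_multiplication//; last exact: integ_abel_cas.
by apply: eq_Rintegral => t _; rewrite /abel_cas mulrA (mulrAC _ t y).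
Qed.

End Poisson.

(** * The Hartley integral contracts the quadratic norm *)

Section Contraction.
Variable R : realType.
Local Notation leb := (@lebesgue_measure R).
Local Notation integ f := (leb.-integrable setT (EFin \o f)).
Implicit Types f g h : R -> R.
Implicit Types e x y a b : R.

Lemma measurable_poisson2 f e : 0 < e -> measurable_fun setT f ->
  measurable_fun [set: measurableTypeR R * measurableTypeR R]
    (fun z : R * R => (f z.1 * poisson e (z.2 - z.1))%:E).
Proof.
move=> e0 mf; apply/measurable_EFinP.
have m1 : measurable_fun [set: measurableTypeR R * measurableTypeR R] (fun z : R * R => z.1).
  exact: measurable_fst.
have m2 : measurable_fun [set: measurableTypeR R * measurableTypeR R] (fun z : R * R => z.2).
  exact: measurable_snd.
apply: measurable_funM; first exact: (measurableT_comp mf m1).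
apply: (measurableT_comp (measurable_poisson0 e0)).
exact: measurable_funB.
Qed.

Lemma integral_mul_poisson_le e f : 0 < e -> measurable_fun setT f ->
  (forall x, 0 <= f x) ->
  (\int[leb]_x \int[leb]_y (f x * poisson e (y - x))%:E <= \int[leb]_x (f x)%:E)%E.
Proof.
move=> e0 mf f0.
have mQ := measurable_poisson2 e0 mf.
apply: ge0_le_integral => //.
- by move=> x _; apply: integral_ge0 => y _; rewrite lee_fin mulr_ge0// poisson_ge0.
- apply: (measurable_fun_fubini_tonelli_F _ mQ) => -[x y] /=.
  by rewrite lee_fin mulr_ge0// poisson_ge0.
- exact/measurable_EFinP.
move=> x _; under eq_integral do rewrite EFinM.
rewrite ge0_integralZl_EFin//.
- by rewrite -[leRHS]mule1 lee_wpmul2l ?integral_poisson_le1// lee_fin.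
- by move=> y _; rewrite lee_fin poisson_ge0.
- by apply/measurable_EFinP; exact: measurable_poisson.
Qed.

(** By [hart_multiplication] and [hart_hart_abel], the left-hand side is the
    integral of [f x * f y * poisson e (y - x)] over the plane.  Since
    [f x * f y <= (f x ^ 2 + f y ^ 2) / 2] and the kernel has mass at most [1] in
    either variable, it is at most the integral of [f ^ 2]. *)
Lemma integral_hart_sqr_abel_le f e : 0 < e -> L1 f -> L2 f ->
  (\int[leb]_xi (hart f xi ^+ 2 * abel e xi)%:E <= \int[leb]_x (f x ^+ 2)%:E)%E.
Proof.
move=> e0 /L1P fi fL2; have mf := integ_measurable fi.
pose g xi := hart f xi * abel e xi.
have gi : integ g by exact: integ_hart_abel.
have ghi : integ (fun xi => hart f xi ^+ 2 * abel e xi).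
  have := integ_mul_bounded gi (measurable_hart fi) (fun x => hart_bound x fi).
  by rewrite /g; under eq_fun do rewrite mulrAC -expr2.
rewrite integral_Rintegral//.
have -> : \int[leb]_xi (hart f xi ^+ 2 * abel e xi) = \int[leb]_y (f y * hart g y).
  by rewrite -hart_multiplication//; apply: eq_Rintegral => t _; rewrite /g mulrA expr2.
rewrite -integral_Rintegral; last first.
  apply: (integ_mul_bounded fi (measurable_hart gi)) => y; exact: hart_bound.
pose Q1 (z : R * R) := (f z.1 ^+ 2 * poisson e (z.2 - z.1))%:E.
have mf2 : measurable_fun setT (fun x => f x ^+ 2) by exact: measurable_funX.
have mQ1 : measurable_fun setT Q1 := measurable_poisson2 e0 mf2.
have Q10 z : (0 <= Q1 z)%E.
  by rewrite lee_fin mulr_ge0 ?sqr_ge0// poisson_ge0.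
apply: (@le_trans _ _
  (\int[leb]_y (2^-1%:E * (\int[leb]_x Q1 (x, y) + \int[leb]_x Q1 (y, x))))%E).
  have mF := measurable_fun_fubini_tonelli_F (m2 := leb) Q1 mQ1 Q10.
  have mG := measurable_fun_fubini_tonelli_G (m1 := leb) Q1 mQ1 Q10.
  apply: (@le_trans _ _ (\int[leb]_y `|f y * hart g y|%:E)%E).
    rewrite (le_trans (lee_abs _))//; apply: le_abse_integral => //.
    apply/measurable_EFinP; apply: (measurable_funM mf); exact: measurable_hart.
  apply: ge0_le_integral => //.
  - apply/measurable_EFinP; apply: measurableT_comp => //.
    by apply: (measurable_funM mf); exact: measurable_hart.
  - by apply: measurable_funeM; apply: emeasurable_funD.
  move=> y _.
  have iP : integ (fun x => f x * poisson e (y - x)).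
    apply: (integ_mul_bounded fi (c := 2 / e)).
      apply: (eq_measurable_fun (fun x => poisson e (x - y)));
        last exact: (measurable_poisson y e0).
      by move=> x _; rewrite poisson_distC.
    by move=> x; exact: poisson_bound.
  have iyP : integ (fun x => f y * (f x * poisson e (y - x))).
    by have := integrableZl measurableT (f y) iP.
  have mQy : measurable_fun setT (fun x : R => Q1 (x, y)).
    apply/measurable_EFinP; apply: (measurable_funM mf2).
    apply: (eq_measurable_fun (fun x => poisson e (x - y)));
        last exact: (measurable_poisson y e0).
    by move=> x _; rewrite poisson_distC.
  have mQy' : measurable_fun setT (fun x : R => Q1 (y, x)).
    apply/measurable_EFinP; rewrite /=; apply: measurable_funM; first exact: measurable_cst.
    exact: (measurable_poisson y e0).
  rewrite hart_hart_abel// -RintegralZl// -abse_EFin -integral_Rintegral//.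
  rewrite (le_trans (le_abse_integral _ _ _))//; first exact: (measurable_int leb iyP).
  rewrite -ge0_integralD// -ge0_integralZl_EFin//; last exact: emeasurable_funD.
    apply: ge0_le_integral => //.
    - by apply: measurableT_comp => //; exact: (measurable_int leb).
    - by apply: measurable_funeM; apply: emeasurable_funD.
    move=> x _; rewrite /Q1/= -EFinD -EFinM lee_fin poisson_distC mulrA normrM.
    rewrite (ger0_norm (poisson_ge0 _ e0)) -mulrDl mulrA ler_wpM2r ?poisson_ge0//.
    rewrite normrM -(real_normK (num_real (f x))) -(real_normK (num_real (f y))).
    by have := sqr_ge0 (`|f x| - `|f y|); set u := `|f x|; set v := `|f y|; nra.
  by move=> x _; rewrite adde_ge0.
have mF := measurable_fun_fubini_tonelli_F (m2 := leb) Q1 mQ1 Q10.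
have mG := measurable_fun_fubini_tonelli_G (m1 := leb) Q1 mQ1 Q10.
rewrite ge0_integralZl_EFin//; first last.
- exact: emeasurable_funD.
- by move=> y _; rewrite adde_ge0// integral_ge0.
rewrite ge0_integralD//; try by move=> y _; exact: integral_ge0.
have h2 := integral_mul_poisson_le e0 mf2 (fun x => sqr_ge0 (f x)).
have h1 := fubini_tonelli (m1 := leb) (m2 := leb) Q1 mQ1 Q10.
rewrite -h1; apply: (@le_trans _ _
  (2^-1%:E * (\int[leb]_x (f x ^+ 2)%:E + \int[leb]_x (f x ^+ 2)%:E))%E).
  by apply: lee_wpmul2l; rewrite ?lee_fin//; apply: leeD.
rewrite -mule2n -mule_natl muleA -EFinM mulVf ?mul1e// pnatr_eq0.
Qed.

Lemma cvg_abel x : abel (k.+1%:R^-1) x @[k --> \oo] --> (1 : R).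
Proof.
rewrite -[X in _ --> X](@expR0 R).
have : - (k.+1%:R^-1 * `|x|) @[k --> \oo] --> - (0 * `|x|).
  by apply: cvgN; apply: cvgM; [exact: cvg_harmonic|exact: cvg_cst].
rewrite mul0r oppr0 => H.
exact: (cvg_comp _ _ H (@continuous_expR R 0)).
Qed.

(** Half of Plancherel's theorem.  The opposite inequality comes from inversion,
    in [hartL2_isometry]. *)
Lemma hart_contraction f : L1 f -> L2 f -> L2 (hart f) /\ nrm (hart f) <= nrm f.
Proof.
move=> fL1 fL2; have /L1P fi := fL1.
have mh := measurable_hart fi.
(* The square of [abel e] is [abel (2 * e)], to which the previous bound applies. *)
pose h (k : nat) xi := hart f xi * abel (k.+1%:R^-1) xi.
have k0 k : 0 < (k.+1%:R)^-1 :> R by rewrite invr_gt0 ltr0n.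
have h2 k : (\int[leb]_xi (h k xi ^+ 2)%:E <= (nrm f ^+ 2)%:E)%E.
  rewrite nrm_sqr//.
  have := @integral_hart_sqr_abel_le f (2 * k.+1%:R^-1) _ fL1 fL2.
  rewrite mulr_gt0// => /(_ isT).
  congr (_ <= _)%E; apply: eq_integral => xi _.
  by rewrite /h exprMn /abel -expRM_natl mulrN mulrA.
have hL k : L2 (h k).
  apply/L2P; split; last exact: le_lt_trans (h2 k) (ltry _).
  apply: (measurable_funM mh); exact: measurable_abel.
apply: (@L2_fatou R h) => //.
- apply: nearW => xi; rewrite /h.
  rewrite -[X in _ --> X]mulr1; apply: cvgM; first exact: cvg_cst.
  exact: cvg_abel.
- exact: nrm_ge0.
- by move=> k; apply: nrm_le => //; exact: nrm_ge0.
Qed.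

End Contraction.

(** * Approximation by integrable functions *)

Section Truncation.
Variable R : realType.
Local Notation leb := (@lebesgue_measure R).
Local Notation integ f := (leb.-integrable setT (EFin \o f)).
Implicit Types f g h : R -> R.
Implicit Types e x y a b : R.

Lemma le_add_cvg0 (u : nat -> R) a b : u n @[n --> \oo] --> (0 : R) ->
  (forall n, a <= b + u n) -> a <= b.
Proof.
move=> u0 ab; apply/ler_addgt0Pr => e e0.
move/cvgrPdist_le : u0 => /(_ _ e0)[n _ /(_ n (leqnn n))]/=.
rewrite sub0r normrN => un; apply: (le_trans (ab n)).
by rewrite lerD2l (le_trans (ler_norm _)).
Qed.

Lemma nrm_cvg0 (u : nat -> R -> R) : (forall n, L2 (u n)) ->
  (\int[leb]_x (u n x ^+ 2)%:E @[n --> \oo] --> 0)%E ->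
  nrm (u n) @[n --> \oo] --> (0 : R).
Proof.
move=> uL /fine_cvgP[_ u0]; apply/cvgrPdist_le => e e0.
have e20 : 0 < e ^+ 2 by rewrite exprn_gt0.
move/cvgrPdist_le : u0 => /(_ _ e20); apply: filterS => n /=.
rewrite !sub0r !normrN -nrm_sqr//= ger0_norm ?sqr_ge0// ger0_norm ?nrm_ge0//.
by rewrite ler_pXn2r// nnegrE ?nrm_ge0// ltW.
Qed.

(** Dominated convergence, in the form common to truncation to large intervals
    and to Abel damping. *)
Lemma L2_mul_cvg h (phi : nat -> R -> R) : L2 h ->
  (forall n, measurable_fun setT (phi n)) ->
  (forall n x, 0 <= phi n x <= 1) ->
  (forall x, phi n x @[n --> \oo] --> (1 : R)) ->
  (forall n, L2 (fun x => h x * phi n x)) /\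
  nrm (fun x => h x * phi n x - h x) @[n --> \oo] --> (0 : R).
Proof.
move=> hL mphi phi01 phi1; have mh := measurable_L2 hL.
have hphiL n : L2 (fun x => h x * phi n x).
  apply: (L2_le _ hL); first exact: measurable_funM.
  move=> x; have /andP[p0 p1] := phi01 n x.
  by rewrite normrM (ger0_norm p0) ler_piMr.
split=> //.
have uL n : L2 (fun x => h x * phi n x - h x) by exact: L2B.
apply: nrm_cvg0 => //.
have mu n := measurable_L2 (uL n).
have [|||||_ _] := @dominated_convergence _ _ R leb setT measurableT
  (fun n x => ((h x * phi n x - h x) ^+ 2)%:E) (fun=> 0%E) (fun x => (h x ^+ 2)%:E).
- by move=> n; apply/measurable_EFinP; exact: (measurable_funX 2 (mu n)).
- exact: measurable_cst.
- apply: nearW => x _; apply: cvg_EFin; first exact: nearW.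
  have H : h x * phi n x - h x @[n --> \oo] --> h x * 1 - h x.
    by apply: cvgB; [apply: cvgM; [exact: cvg_cst|exact: phi1]|exact: cvg_cst].
  have := cvg_comp _ _ H (@exprn_continuous R 2%N _).
  by rewrite mulr1 subrr expr0n.
- exact: integ_sqr_L2.
- apply: nearW => x n _ /=; rewrite lee_fin ger0_norm ?sqr_ge0//.
  have /andP[p0 p1] := phi01 n x.
  rewrite (_ : h x * phi n x - h x = h x * (phi n x - 1)); last by ring.
  rewrite exprMn ler_piMr ?sqr_ge0//; nra.
by rewrite integral0.
Qed.

Definition trunc n f : R -> R := fun x => f x * \1_(`[- n%:R, n%:R]%classic) x.

Lemma L12_indic_itv a b :
  L1 (\1_(`[a, b]%classic) : R -> R) /\ L2 (\1_(`[a, b]%classic) : R -> R).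
Proof.
have hi : integ (\1_(`[a, b]%classic) : R -> R) by exact: integrable_indic_itv.
split; first exact/L1P.
apply/L2P; split; first exact: measurable_indic.
have := integrable_lty measurableT hi.
congr (_ < _)%E; apply: eq_integral => x _ /=.
by rewrite indicE; case: (_ \in _); rewrite ?expr1n ?expr0n.
Qed.

Lemma truncP f : L2 f -> [/\ forall n, L1 (trunc n f), forall n, L2 (trunc n f) &
  nrm (fun x => trunc n f x - f x) @[n --> \oo] --> (0 : R)].
Proof.
move=> fL.
have [|||tL tc] := @L2_mul_cvg f (fun n => \1_(`[- n%:R, n%:R]%classic)) fL.
- move=> n; exact: measurable_indic.
- by move=> n x; rewrite indicE; case: (_ \in _); rewrite ?lexx ?ler01.
- move=> x; apply: cvg_near_cst.
  exists (Num.truncn `|x|).+1 => // n /= xn.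
  apply/eqP; rewrite indicE mem_set//= in_itv/= -ler_norml.
  by rewrite (le_trans (ltW (truncnS_gt _)))// ler_nat.
split => // n; rewrite /L1/=.
exact: (Lfun2_mul_Lfun1 fL (L12_indic_itv _ _).2).
Qed.

End Truncation.

(** * The Hartley transform of square-integrable functions *)

Section HartleyL2.
Variable R : realType.
Local Notation leb := (@lebesgue_measure R).
Local Notation integ f := (leb.-integrable setT (EFin \o f)).
Implicit Types f g h : R -> R.
Implicit Types e x y a b : R.

Lemma L1B f g : L1 f -> L1 g -> L1 (fun x => f x - g x).
Proof. by move=> /L1P fi /L1P gi; apply/L1P; exact: (integrableB measurableT fi gi). Qed.

Lemma L2_hart f : L1 f -> L2 f -> L2 (hart f).
Proof. by move=> f1 f2; have [] := hart_contraction f1 f2. Qed.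

Lemma hart_dist f g : L1 f -> L2 f -> L1 g -> L2 g ->
  nrm (fun x => hart f x - hart g x) <= nrm (fun x => f x - g x).
Proof.
move=> f1 f2 g1 g2; have [_] := hart_contraction (L1B f1 g1) (L2B f2 g2).
congr (nrm _ <= _); apply/funext => x.
by rewrite hartB//; exact/L1P.
Qed.

(** A limit in [L2] of the transforms of the truncations, which exists by
    [hart_contraction] and [L2_complete] and is unique up to a null set. *)
Definition hartL2 f : R -> R := xget (fun=> 0)
  [set g | L2 g /\ nrm (fun x => hart (trunc n f) x - g x) @[n --> \oo] --> (0 : R)].

Lemma hartL2P f : L2 f -> L2 (hartL2 f) /\
  nrm (fun x => hart (trunc n f) x - hartL2 f x) @[n --> \oo] --> (0 : R).
Proof.
move=> fL; have [t1 t2 tc] := truncP fL.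
suff [g gL gc] : exists2 g, L2 g &
    nrm (fun x => hart (trunc n f) x - g x) @[n --> \oo] --> (0 : R).
  by rewrite /hartL2; case: xgetP => [h -> []//|/(_ g)[]].
apply: L2_complete; first by move=> k; apply: L2_hart.
move=> e e0; have e20 : 0 < e / 2 by rewrite divr_gt0.
move/cvgrPdist_le : tc => /(_ _ e20)[N _ NP]; exists N => m n Nm Nn.
rewrite (le_trans (hart_dist _ _ _ _))// (le_trans (nrm_dist (t2 m) fL (t2 n)))//.
rewrite [leRHS](splitr e); apply: lerD.
  by have := NP _ Nm; rewrite /= sub0r normrN ger0_norm ?nrm_ge0.
by have := NP _ Nn; rewrite /= sub0r normrN ger0_norm ?nrm_ge0// nrm_distC.
Qed.

Lemma L2_hartL2 f : L2 f -> L2 (hartL2 f). Proof. by move=> /hartL2P[]. Qed.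

(** The contraction property when only one of the two functions is integrable; it
    gives at once that [hartL2] extends [hart] and that it is a contraction. *)
Lemma hart_hartL2_dist f g : L1 f -> L2 f -> L2 g ->
  nrm (fun x => hart f x - hartL2 g x) <= nrm (fun x => f x - g x).
Proof.
move=> f1 f2 gL; have [t1 t2 tc] := truncP gL; have [eL ec] := hartL2P gL.
have u0 : nrm (fun x => trunc n g x - g x) + nrm (fun x => hart (trunc n g) x - hartL2 g x)
    @[n --> \oo] --> (0 : R).
  by rewrite -[X in _ --> X]addr0; exact: cvgD.
apply: (le_add_cvg0 u0) => n.
rewrite (le_trans (nrm_dist (L2_hart f1 f2) (L2_hart (t1 n) (t2 n)) eL))//.
rewrite addrA lerD2r (le_trans (hart_dist _ _ _ _))// (le_trans (nrm_dist f2 gL (t2 n)))//.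
by rewrite lerD2l nrm_distC.
Qed.

Lemma hartL2_contraction f g : L2 f -> L2 g ->
  nrm (fun x => hartL2 f x - hartL2 g x) <= nrm (fun x => f x - g x).
Proof.
move=> fL gL; have [t1 t2 tc] := truncP fL.
have u0 : nrm (fun x => trunc n f x - f x) + nrm (fun x => trunc n f x - f x)
    @[n --> \oo] --> (0 : R).
  by rewrite -[X in _ --> X]addr0; exact: cvgD.
apply: (le_add_cvg0 u0) => n.
rewrite (le_trans (nrm_dist (L2_hartL2 fL) (L2_hart (t1 n) (t2 n)) (L2_hartL2 gL)))//.
have A := hart_hartL2_dist (t1 n) (t2 n) fL.
have B := hart_hartL2_dist (t1 n) (t2 n) gL.
have C := nrm_dist (t2 n) fL gL.
rewrite nrm_distC [leRHS]addrC -addrA; apply: lerD; first exact: A.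
exact: (le_trans B C).
Qed.

Lemma hartL2_hart f : L1 f -> L2 f -> {ae leb, forall x, hartL2 f x = hart f x}.
Proof.
move=> f1 f2; apply: nrm_eq0_ae_eq; [exact: L2_hartL2|exact: L2_hart|].
rewrite nrm_distC; apply/eqP; rewrite eq_le nrm_ge0 andbT.
rewrite (le_trans (hart_hartL2_dist f1 f2 f2))//.
apply: nrm_le => //; first exact: L2B.
under eq_integral do rewrite subrr expr0n/=.
by rewrite integral0 expr0n.
Qed.

Lemma cauchy_schwarz_L2 f g : L2 f -> L2 g ->
  `|\int[leb]_x (f x * g x)| <= nrm f * nrm g.
Proof.
move=> fL gL; have fgi : integ (fun x => f x * g x).
  by apply/L1P; exact: (Lfun2_mul_Lfun1 fL gL).
have mf := measurable_L2 fL; have mg := measurable_L2 gL.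
rewrite -lee_fin EFinM -!L2_fin// -abse_EFin -integral_Rintegral//.
rewrite (le_trans (le_abse_integral _ _ _))//; first exact: (measurable_int leb fgi).
have := @hoelder _ _ R leb f g 2 2 mf mg.
by rewrite Lnorm1; apply => //; rewrite [RHS]splitr !div1r.
Qed.

Lemma L2_locally_integrable f : L2 f -> locally_integrable setT f.
Proof.
move=> fL; have mf := measurable_L2 fL; split => //; first exact: openT.
move=> K _ cK; have mK : measurable K by exact: compact_measurable.
apply: (@le_lt_trans _ _ (\int[leb]_(x in K) (1%:E + (f x ^+ 2)%:E))%E).
  apply: ge0_le_integral => //.
  - apply: measurable_funTS; apply/measurable_EFinP; exact: measurableT_comp.
  - apply: measurable_funTS; apply/measurable_EFinP; apply: measurable_funD => //.
    exact: measurable_funX.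
  - move=> x _; rewrite -EFinD lee_fin -(real_normK (num_real (f x))).
    have := sqr_ge0 (`|f x| - 1); have := normr_ge0 (f x); set u := `|f x|; nra.
rewrite ge0_integralD//; first last.
- by apply: measurable_funTS; apply/measurable_EFinP; exact: measurable_funX.
- by move=> x _; rewrite lee_fin sqr_ge0.
rewrite lte_add_pinfty//.
  by rewrite integral_cst// mul1e; exact: compact_finite_measure.
apply: le_lt_trans (integrable_lty measurableT (integ_sqr_L2 fL)).
apply: ge0_subset_integral => //.
- by apply/measurable_EFinP; exact: measurable_funX.
- by move=> x _; rewrite lee_fin sqr_ge0.
Qed.

(** At a Lebesgue point [x], the value [f x] is the derivative of the integral of
    [f] up to [x], which vanishes identically here. *)
Lemma L2_integral_itv0_ae f : L2 f ->
  (forall a b, a < b -> \int[leb]_(x in `[a, b]) f x = 0) ->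
  {ae leb, forall x, f x = 0}.
Proof.
move=> fL f0; have lf := L2_locally_integrable fL.
have := lebesgue_differentiation lf; apply: aeS => x fx.
have x1 : x < x + 1 by rewrite ltrDl.
have i1 : leb.-integrable `[x - 1, x + 1] (EFin \o f).
  apply/integrableP; split.
    by apply: measurable_funTS; apply/measurable_EFinP; exact: measurable_L2.
  by case: lf => _ _; apply => //; exact: segment_compact.
have [|_] := @FTC1_lebesgue_pt R f (BLeft (x - 1)) x (x + 1) x1 i1 _ fx.
  by rewrite lte_fin ltrBlDr.
move=> <-; rewrite derive1E.
have -> : (fun y : R =>
    \int[leb]_(t in [set` Interval (BLeft (x - 1)) (BRight y)]) f t) = cst 0.
  apply/funext => y; have [xy|yx|<-] := ltgtP (x - 1) y; first exact: f0.
    by rewrite set_itv_ge ?Rintegral_set0// bnd_simp -ltNge.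
  by rewrite set_itv1 Rintegral_set1.
exact: derive_cst.
Qed.

End HartleyL2.
#[local] Opaque hartL2.

(** * Inversion *)

Section Involution.
Variable R : realType.
Local Notation leb := (@lebesgue_measure R).
Local Notation integ f := (leb.-integrable setT (EFin \o f)).
Implicit Types f g h : R -> R.
Implicit Types e x y a b : R.

Lemma cvg_atan_scale (x : R) : 0 < x ->
  atan (2 * pi / k.+1%:R^-1 * x) @[k --> \oo] --> (pi / 2 : R).
Proof.
move=> x0.
have H : (2 * pi / k.+1%:R^-1 * x : R) @[k --> \oo] --> +oo.
  under eq_fun do rewrite invrK mulrAC.
  have M0 : 0 < 2 * pi * x :> R by rewrite !mulr_gt0 ?pi_gt0.
  apply/cvgryPge => A; apply: filterS (nbhs_infty_ger (A / (2 * pi * x))) => k.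
  rewrite ler_pdivrMr// mulrC => /le_trans; apply.
  by rewrite ler_pM2l// ler_nat.
exact: (cvg_comp _ _ H (@cvgy_atan R)).
Qed.

(** The Poisson mean of the indicator of [`[a, b]]; see [hart_indic_abel]. *)
Definition jump e a b y : R :=
  pi^-1 * (atan (2 * pi / e * (b - y)) - atan (2 * pi / e * (a - y))).

Lemma jump_bound e a b y : `|jump e a b y| <= 1.
Proof.
rewrite /jump normrM ger0_norm ?invr_ge0 ?pi_ge0//.
rewrite mulrC ler_pdivrMr ?pi_gt0// mul1r.
set u := 2 * pi / e * (b - y); set v := 2 * pi / e * _.
have := atan_ltpi2 u; have := atan_gtNpi2 u.
have := atan_ltpi2 v; have := atan_gtNpi2 v.
by move=> *; rewrite ler_norml; apply/andP; split; lra.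
Qed.

Lemma cvg_jump a b y : a < b -> y != a -> y != b ->
  jump k.+1%:R^-1 a b y @[k --> \oo] --> (\1_(`[a, b]%classic) y : R).
Proof.
move=> ab ya yb.
have pi0 : pi != 0 :> R by rewrite gt_eqF ?pi_gt0.
have L x : x != y -> atan (2 * pi / k.+1%:R^-1 * (x - y)) @[k --> \oo] -->
    (if y < x then pi / 2 else - (pi / 2)).
  move=> xy; case: ltP => yx; first by apply: cvg_atan_scale; rewrite subr_gt0.
  under eq_fun do rewrite -opprB mulrN atanN.
  by apply: cvgN; apply: cvg_atan_scale; rewrite subr_gt0 lt_neqAle xy.
have := L a; rewrite eq_sym => /(_ ya) La.
have := L b; rewrite eq_sym => /(_ yb) Lb.
have -> : \1_(`[a, b]%classic) y = pi^-1 *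
   ((if y < b then pi / 2 else - (pi / 2)) - (if y < a then pi / 2 else - (pi / 2))) :> R.
  rewrite indicE mem_setE/= in_itv/=.
  rewrite [a <= y]le_eqVlt eq_sym (negbTE ya)/= [y <= b]le_eqVlt (negbTE yb)/=.
  have [ay|ay|ay] := ltgtP a y; last by rewrite ay eqxx in ya.
  - case: ltP => yb' /=; last by rewrite subrr mulr0.
    by rewrite opprK -splitr mulVf.
  - by rewrite (lt_trans ay ab)/= subrr mulr0.
exact: (cvgM (cvg_cst pi^-1) (cvgB Lb La)).
Qed.

Lemma ae_neq a : {ae leb, forall x, x != a}.
Proof.
exists [set a]; split; [exact: measurable_set1|exact: lebesgue_measure_set1|].
by move=> x /= /negP; rewrite negbK => /eqP.
Qed.

Lemma Rintegral_itv_indic f a b : \int[leb]_(x in `[a, b]) f x =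
  \int[leb]_x (f x * \1_(`[a, b]%classic) x).
Proof. by rewrite Rintegral_mkcond; apply: eq_Rintegral => x _; rewrite patch_indic. Qed.

Lemma hart_indic_abel e a b y : 0 < e -> a < b ->
  hart (fun xi => hart (\1_(`[a, b]%classic)) xi * abel e xi) y = jump e a b y.
Proof.
move=> e0 ab; rewrite hart_hart_abel//; last by apply/L1P; exact: (L12_indic_itv _ _).1.
under eq_Rintegral do rewrite mulrC poisson_distC.
by rewrite -Rintegral_itv_indic /Rintegral integral_poisson_itv.
Qed.

(** With [A k] the transform of [f] damped by [abel (k.+1%:R^-1)], the integral
    [s k] of [hart (A k)] over [`[a, b]] is computed in two ways.  As [A k] tends
    to [hart f] in [L2], it tends to the integral of [hartL2 (hart f)]; moving both
    transforms to the indicator, it is the integral of [f] against the Poisson mean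
    of the indicator, which tends to the integral of [f]. *)
Lemma hartL2_hartK f : L1 f -> L2 f -> {ae leb, forall x, hartL2 (hart f) x = f x}.
Proof.
move=> f1 f2; have fi : integ f by apply/L1P.
have hL := L2_hart f1 f2; have eL := L2_hartL2 hL.
pose phi k : R -> R := abel (k.+1%:R^-1).
have k0 k : 0 < (k.+1%:R)^-1 :> R by rewrite invr_gt0 ltr0n.
have [|||aL ac] := @L2_mul_cvg R (hart f) phi hL.
- by move=> k; exact: measurable_abel.
- move=> k x; rewrite abel_ge0/= -[leRHS](@expR0 R) ler_expR oppr_le0.
  by rewrite mulr_ge0// ltW.
- exact: cvg_abel.
pose A k xi := hart f xi * phi k xi.
have A1 k : L1 (A k) by apply/L1P; exact: integ_hart_abel.
have AL k : L2 (A k) := aL k.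
suff : {ae leb, forall x, hartL2 (hart f) x - f x = 0}.
  by apply: aeS => x /eqP; rewrite subr_eq0 => /eqP.
apply: L2_integral_itv0_ae; first exact: L2B.
move=> a b ab; have [I1 I2] := L12_indic_itv a b.
have /L1P Ii := I1.
have mulI g : L2 g -> integ (fun x => g x * \1_(`[a, b]%classic) x).
  by move=> gL; apply/L1P; exact: (Lfun2_mul_Lfun1 gL I2).
rewrite Rintegral_itv_indic.
under eq_Rintegral do rewrite mulrBl.
rewrite RintegralB//; [|exact: mulI|exact: mulI].
apply/eqP; rewrite subr_eq0; apply/eqP.
pose s k := \int[leb]_x (hart (A k) x * \1_(`[a, b]%classic) x).
apply: (@cvg_unique _ (@Rhausdorff R) (s @ \oo)).
- have bd k : `|\int[leb]_x (hartL2 (hart f) x * \1_(`[a, b]%classic) x) - s k| <=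
      nrm (fun x => A k x - hart f x) * nrm (\1_(`[a, b]%classic)).
    have hAL := L2_hart (A1 k) (AL k).
    rewrite -RintegralB//; [|exact: mulI|exact: mulI].
    under eq_Rintegral do rewrite -mulrBl.
    rewrite (le_trans (cauchy_schwarz_L2 (L2B eL hAL) I2))//.
    by rewrite ler_wpM2r ?nrm_ge0// nrm_distC hart_hartL2_dist.
  have b0 : nrm (fun x => A k x - hart f x) * nrm (\1_(`[a, b]%classic))
      @[k --> \oo] --> (0 : R).
    rewrite -[X in _ --> X](mul0r (nrm (\1_(`[a, b]%classic)))).
    by apply: cvgM => //; exact: cvg_cst.
  apply/cvgrPdist_le => e e0; move/cvgrPdist_le : b0 => /(_ _ e0).
  apply: filterS => k; rewrite sub0r normrN => ke.
  by rewrite (le_trans (bd k))// (le_trans (ler_norm _)).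
- have sE k : s k = \int[leb]_x (f x * jump k.+1%:R^-1 a b x).
    rewrite /s hart_multiplication//; last by exact/L1P.
    under eq_Rintegral do rewrite /A -mulrA (mulrC (phi k _)).
    rewrite hart_multiplication//; last exact: integ_hart_abel.
    by apply: eq_Rintegral => x _; rewrite hart_indic_abel.
  have mj k : measurable_fun setT (jump k.+1%:R^-1 a b).
    rewrite (_ : jump _ _ _ =
        hart (fun xi => hart (\1_(`[a, b]%classic)) xi * abel k.+1%:R^-1 xi)).
      by apply: measurable_hart; exact: integ_hart_abel.
    by apply/funext => x; rewrite hart_indic_abel.
  have mf := integ_measurable fi; have nfi := integrable_norm fi.
  have [|||||_ _] := @dominated_convergence _ _ R leb setT measurableT
    (fun k x => (f x * jump k.+1%:R^-1 a b x)%:E) (fun x => (f x * \1_(`[a, b]%classic) x)%:E)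
    (fun x => `|f x|%:E).
  + by move=> k; apply/measurable_EFinP; exact: (measurable_funM mf (mj k)).
  + exact: (measurable_int leb (mulI _ f2)).
  + apply: aeS2 (ae_neq a) (ae_neq b) => x xa xb _.
    apply: cvg_EFin; first exact: nearW.
    by apply: cvgM; [exact: cvg_cst|exact: cvg_jump].
  + exact: nfi.
  + apply: nearW => x k _ /=; rewrite lee_fin normrM.
    by rewrite ler_piMr// jump_bound.
  rewrite (integral_Rintegral (mulI _ f2)) => /fine_cvgP[_].
  rewrite (_ : s = fun k => \int[leb]_x (f x * jump k.+1%:R^-1 a b x))//.
  exact/funext.
Qed.

End Involution.

(** * The Fourier-Plancherel transform *)

Section Plancherel.
Variable R : realType.
Local Notation leb := (@lebesgue_measure R).
Local Notation integ f := (leb.-integrable setT (EFin \o f)).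
Implicit Types f g h u v w : R -> R.
Implicit Types e x y a b : R.

Lemma hartL2K f : L2 f -> {ae leb, forall x, hartL2 (hartL2 f) x = f x}.
Proof.
move=> fL; have [t1 t2 tc] := truncP fL; have [eL ec] := hartL2P fL.
apply: nrm_eq0_ae_eq; [exact: (L2_hartL2 eL)|exact: fL|].
apply/eqP; rewrite eq_le nrm_ge0 andbT.
have u0 : nrm (fun x => hart (trunc n f) x - hartL2 f x) + nrm (fun x => trunc n f x - f x)
    @[n --> \oo] --> (0 : R).
  by rewrite -[X in _ --> X]addr0; exact: cvgD.
apply: (le_add_cvg0 u0) => n; rewrite add0r.
have hL := L2_hart (t1 n) (t2 n).
apply: (le_trans (nrm_dist (L2_hartL2 eL) (L2_hartL2 hL) fL)); apply: lerD.
  by rewrite [leRHS]nrm_distC; exact: hartL2_contraction.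
rewrite (_ : nrm (fun x => hartL2 (hart (trunc n f)) x - f x) =
  nrm (fun x => trunc n f x - f x))//.
apply: ae_eq_nrm.
- exact: measurable_L2 (L2B (L2_hartL2 hL) fL).
- exact: measurable_L2 (L2B (t2 n) fL).
- by apply: aeS (hartL2_hartK (t1 n) (t2 n)) => x ->.
Qed.

(** A contraction which is an involution loses no norm. *)
Lemma hartL2_isometry f g : L2 f -> L2 g ->
  nrm (fun x => hartL2 f x - hartL2 g x) = nrm (fun x => f x - g x).
Proof.
move=> fL gL; apply/eqP; rewrite eq_le hartL2_contraction//=.
have [efL egL] := (L2_hartL2 fL, L2_hartL2 gL).
rewrite (_ : nrm (fun x => f x - g x) =
  nrm (fun x => hartL2 (hartL2 f) x - hartL2 (hartL2 g) x)).
  exact: hartL2_contraction.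
apply: ae_eq_nrm.
- exact: measurable_L2 (L2B fL gL).
- exact: measurable_L2 (L2B (L2_hartL2 efL) (L2_hartL2 egL)).
- by apply: aeS2 (hartL2K fL) (hartL2K gL) => x h1 h2; rewrite -[in LHS]h1 -[in LHS]h2.
Qed.

Lemma ae_reflect (P : R -> Prop) : {ae leb, forall x, P x} -> {ae leb, forall x, P (- x)}.
Proof.
move=> [A [mA A0 PA]]; exists ((-%R : _ -> measurableTypeR R) @^-1` A); split.
- by have := @oppr_measurable R setT measurableT A mA; rewrite setTI.
- by have := lebesgue_measureN mA; rewrite /pushforward A0.
- by move=> x /= nP; apply: PA.
Qed.

Lemma L2_reflect f : L2 f -> L2 (fun x => f (- x)).
Proof.
move=> /L2P[mf fi]; apply/L2P; split.
  by apply: (measurableT_comp mf); exact: oppr_measurable.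
rewrite (ge0_integral_reflect (f := fun x => (f x ^+ 2)%:E))//.
- by apply/measurable_EFinP; exact: measurable_funX.
- by move=> x; rewrite lee_fin sqr_ge0.
Qed.

Lemma sqr_normcE (z : R[i]) : Normc.normc z ^+ 2 = complex.Re z ^+ 2 + complex.Im z ^+ 2.
Proof. by case: z => a b /=; rewrite sqr_sqrtr// addr_ge0 ?sqr_ge0. Qed.

Lemma normL2CE (g : R -> R[i]) : (normL2C g =
  (\int[leb]_x (complex.Re (g x) ^+ 2 + complex.Im (g x) ^+ 2)%:E) `^ 2^-1)%E.
Proof.
rewrite /normL2C unlock; congr (_ `^ _)%E; apply: eq_integral => x _ /=.
by rewrite powR_mulrn// -sqr_normcE -normrX ger0_norm// sqr_ge0.
Qed.

Definition even_part h xi := (h xi + h (- xi)) / 2.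
Definition odd_part h xi := (h xi - h (- xi)) / 2.
(** The linear isomorphism between real functions and hermitian functions under
    which the Hartley transform becomes the Fourier transform. *)
Definition hermitian_of h xi : R[i] := even_part h xi +i* - odd_part h xi.

Lemma even_odd h x : h x = even_part h x + odd_part h x.
Proof. by rewrite /even_part /odd_part; field. Qed.

Definition fourierL2 f : R -> R[i] := hermitian_of (hartL2 f).

Lemma hermitianB h g x :
  hermitian_of h x - hermitian_of g x = hermitian_of (fun y => h y - g y) x.
Proof.
rewrite /hermitian_of /even_part /odd_part.
by apply/eqP; rewrite eq_complex/=; apply/andP; split; apply/eqP; field.
Qed.

Lemma L2C_hermitian h : L2 h -> L2C (hermitian_of h).
Proof.
move=> hL; have hL' := L2_reflect hL; split.
  rewrite (_ : (fun x => _) = fun x => 2^-1 * (h x + h (- x))); first exact/L2Z/L2D.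
  by apply/funext => x; rewrite mulrC.
rewrite (_ : (fun x => _) = fun x => (- 2^-1) * (h x - h (- x))); first exact/L2Z/L2B.
by apply/funext => x; rewrite /hermitian_of/= /odd_part mulNr mulrC.
Qed.

(** The square modulus at [x] is the mean of [h x ^ 2] and [h (- x) ^ 2], and the
    two terms have the same integral. *)
Lemma normL2C_hermitian h : L2 h -> normL2C (hermitian_of h) = normL2 h.
Proof.
move=> hL; rewrite normL2CE normL2E; congr (_ `^ _)%E.
have mh := measurable_L2 hL; have mh' := measurable_L2 (L2_reflect hL).
have -> : (\int[leb]_x (complex.Re (hermitian_of h x) ^+ 2 +
                        complex.Im (hermitian_of h x) ^+ 2)%:E =
    \int[leb]_x (2^-1%:E * ((h x ^+ 2)%:E + (h (- x) ^+ 2)%:E)))%E.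
  apply: eq_integral => x _; rewrite -EFinD -EFinM; congr EFin.
  by rewrite /hermitian_of/= /even_part /odd_part; field.
rewrite ge0_integralZl_EFin//; first last.
- apply/measurable_EFinP; apply: measurable_funD; exact: measurable_funX.
- by move=> x _; rewrite -EFinD lee_fin addr_ge0 ?sqr_ge0.
rewrite ge0_integralD//; first last.
- by apply/measurable_EFinP; exact: measurable_funX.
- by move=> x _; rewrite lee_fin sqr_ge0.
- by apply/measurable_EFinP; exact: measurable_funX.
- by move=> x _; rewrite lee_fin sqr_ge0.
rewrite (ge0_integral_reflect (f := fun x => (h x ^+ 2)%:E)); first last.
- by move=> x; rewrite lee_fin sqr_ge0.
- by apply/measurable_EFinP; exact: measurable_funX.
by rewrite -mule2n -mule_natl muleA -EFinM mulVf ?mul1e// pnatr_eq0.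
Qed.

Lemma continuous_sin_scal a : continuous (fun t => sin (a * t)).
Proof.
move=> t; exact: (continuous_comp (@continuous_scal R a t) (@continuous_sin R _)).
Qed.

Lemma fourier_hart f xi : L1 f -> fourier f xi = hermitian_of (hart f) xi.
Proof.
move=> /L1P fi.
have fcos : integ (fun x => f x * cos (2 * pi * x * xi)).
  apply: (integ_mul_bounded fi) => [|x]; last exact: cos_max.
  apply: (eq_measurable_fun (fun x => cos (2 * pi * xi * x))).
    by move=> x _; rewrite mulrAC.
  by apply: continuous_measurable_fun; exact: continuous_cos_scal.
have fsin : integ (fun x => f x * sin (2 * pi * x * xi)).
  apply: (integ_mul_bounded fi) => [|x]; last exact: sin_max.
  apply: (eq_measurable_fun (fun x => sin (2 * pi * xi * x))).
    by move=> x _; rewrite mulrAC.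
  by apply: continuous_measurable_fun; exact: continuous_sin_scal.
have hE : hart f xi = \int[leb]_x (f x * cos (2 * pi * x * xi)) +
    \int[leb]_x (f x * sin (2 * pi * x * xi)).
  rewrite hartE -RintegralD//; apply: eq_Rintegral => x _; by rewrite mulrDr.
have hNE : hart f (- xi) = \int[leb]_x (f x * cos (2 * pi * x * xi)) -
    \int[leb]_x (f x * sin (2 * pi * x * xi)).
  rewrite hartE -RintegralB//; apply: eq_Rintegral => x _.
  by rewrite /cas mulrN cosN sinN mulrBr.
have addE (c d : R) : (c + d + (c - d)) / 2 = c by field.
have subE (c d : R) : - ((c + d - (c - d)) / 2) = - d by field.
rewrite /fourier /Cintegral /hermitian_of /even_part /odd_part hE hNE addE subE.
congr (_ +i* _).
  by apply: eq_Rintegral => x _; rewrite /= mulr0 subr0 cosN mulrC.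
rewrite -mulN1r -RintegralZl//.
by apply: eq_Rintegral => x _; rewrite /= mulr0 add0r sinN mulN1r mulNr mulrC.
Qed.

Lemma fourierL2_isometric_extension : isometric_extension fourierL2.
Proof.
split.
- by move=> w wL; apply: L2C_hermitian; exact: L2_hartL2.
- move=> w v wL vL; have [ewL evL] := (L2_hartL2 wL, L2_hartL2 vL).
  rewrite (_ : (fun xi => _) = hermitian_of (fun x => hartL2 w x - hartL2 v x)).
    rewrite normL2C_hermitian; last exact: L2B.
    by rewrite !L2_fin ?hartL2_isometry//; exact: L2B.
  by apply/funext => x; rewrite hermitianB.
- move=> w w1 w2; have hw := hartL2_hart w1 w2.
  apply: aeS2 hw (ae_reflect hw) => x hx hx'.
  by rewrite fourier_hart// /fourierL2 /hermitian_of /even_part /odd_part hx hx'.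
Qed.


Lemma isometric_extension_contraction (Phi : (R -> R) -> R -> R[i]) w v :
  isometric_extension Phi -> L2 w -> L2 v ->
  nrm (fun x => complex.Re (Phi w x) - complex.Re (Phi v x)) <= nrm (fun x => w x - v x) /\
  nrm (fun x => complex.Im (Phi w x) - complex.Im (Phi v x)) <= nrm (fun x => w x - v x).
Proof.
move=> [PL Piso _] wL vL; have [wR wI] := PL _ wL; have [vR vI] := PL _ vL.
have wvL := L2B wL vL.
have := congr1 (fun t => t `^ 2)%E (Piso _ _ wL vL).
rewrite normL2CE normL2E -!poweRrM mulVf// !poweRe1//; last 2 first.
- exact: sqint_ge0.
- by apply: integral_ge0 => x _; rewrite lee_fin addr_ge0 ?sqr_ge0.
rewrite -nrm_sqr// => E.
have bRI : (\int[leb]_x (complex.Re (Phi w x - Phi v x) ^+ 2 +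
                         complex.Im (Phi w x - Phi v x) ^+ 2)%:E =
  \int[leb]_x ((complex.Re (Phi w x) - complex.Re (Phi v x)) ^+ 2)%:E +
  \int[leb]_x ((complex.Im (Phi w x) - complex.Im (Phi v x)) ^+ 2)%:E)%E.
  rewrite -ge0_integralD//.
  - by apply: eq_integral => x _; case: (Phi w x) => a b; case: (Phi v x).
  - by move=> x _; rewrite lee_fin sqr_ge0.
  - apply/measurable_EFinP; apply: measurable_funX; exact: measurable_L2 (L2B wR vR).
  - by move=> x _; rewrite lee_fin sqr_ge0.
  - apply/measurable_EFinP; apply: measurable_funX; exact: measurable_L2 (L2B wI vI).
split.
- apply: nrm_le (nrm_ge0 _) (L2B wR vR) _.
  by rewrite -E bRI leeDl// sqint_ge0.
- apply: nrm_le (nrm_ge0 _) (L2B wI vI) _.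
  by rewrite -E bRI leeDr// sqint_ge0.
Qed.

(** Two continuous maps that agree on the truncations, which are dense; the real
    and the imaginary parts are treated separately so that only the norm of real
    functions is involved. *)
Lemma isometric_extension_unique (Phi Psi : (R -> R) -> R -> R[i]) f :
  isometric_extension Phi -> isometric_extension Psi -> L2 f ->
  {ae leb, forall xi, Phi f xi = Psi f xi}.
Proof.
move=> HP HQ fL; have [t1 t2 tc] := truncP fL.
have [[PL _ PF] [QL _ QF]] := (HP, HQ).
have u0 : nrm (fun x => trunc n f x - f x) + nrm (fun x => trunc n f x - f x)
    @[n --> \oo] --> (0 : R).
  by rewrite -[X in _ --> X]addr0; exact: cvgD.
have PQ n : {ae leb, forall xi, Phi (trunc n f) xi = Psi (trunc n f) xi}.
  by apply: aeS2 (PF _ (t1 n) (t2 n)) (QF _ (t1 n) (t2 n)) => x -> ->.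
have [PR PI] := PL _ fL; have [QR QI] := QL _ fL.
have R0 : {ae leb, forall x, complex.Re (Phi f x) = complex.Re (Psi f x)}.
  apply: nrm_eq0_ae_eq => //; apply/eqP; rewrite eq_le nrm_ge0 andbT.
  apply: (le_add_cvg0 u0) => n; rewrite add0r.
  have [tPR _] := PL _ (t2 n); have [tQR _] := QL _ (t2 n).
  rewrite (le_trans (nrm_dist PR tPR QR))//; apply: lerD.
    rewrite [leRHS]nrm_distC.
    by have [] := isometric_extension_contraction HP fL (t2 n).
  have [+ _] := isometric_extension_contraction HQ (t2 n) fL.
  congr (_ <= _); apply: ae_eq_nrm.
  - exact: measurable_L2 (L2B tQR QR).
  - exact: measurable_L2 (L2B tPR QR).
  - by apply: aeS (PQ n) => x ->.
have I0 : {ae leb, forall x, complex.Im (Phi f x) = complex.Im (Psi f x)}.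
  apply: nrm_eq0_ae_eq => //; apply/eqP; rewrite eq_le nrm_ge0 andbT.
  apply: (le_add_cvg0 u0) => n; rewrite add0r.
  have [_ tPI] := PL _ (t2 n); have [_ tQI] := QL _ (t2 n).
  rewrite (le_trans (nrm_dist PI tPI QI))//; apply: lerD.
    rewrite [leRHS]nrm_distC.
    by have [] := isometric_extension_contraction HP fL (t2 n).
  have [_ +] := isometric_extension_contraction HQ (t2 n) fL.
  congr (_ <= _); apply: ae_eq_nrm.
  - exact: measurable_L2 (L2B tQI QI).
  - exact: measurable_L2 (L2B tPI QI).
  - by apply: aeS (PQ n) => x ->.
by apply: aeS2 R0 I0 => x; case: (Phi f x) => a b; case: (Psi f x) => c d /= -> ->.
Qed.

Lemma plancherel_isometric_extension : isometric_extension (@plancherel R).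
Proof. exact: xgetPex (ex_intro _ _ fourierL2_isometric_extension). Qed.

(** Whichever extension is chosen, its values are given by the Hartley
    transform. *)
Lemma plancherelE f : L2 f -> {ae leb, forall xi, plancherel f xi = fourierL2 f xi}.
Proof.
apply: isometric_extension_unique; first exact: plancherel_isometric_extension.
exact: fourierL2_isometric_extension.
Qed.

Lemma plancherel_inj u v : L2 u -> L2 v ->
  {ae leb, forall xi, plancherel u xi = plancherel v xi} ->
  {ae leb, forall x, u x = v x}.
Proof.
move=> uL vL uv; have [PL _ _] := plancherel_isometric_extension.
have E : {ae leb, forall x, hartL2 u x = hartL2 v x}.
  have H := aeS2 _ (plancherelE uL) (plancherelE vL).
  have H2 : {ae leb, forall x, fourierL2 u x = fourierL2 v x}.
    by apply: (aeS2 _ uv); last (apply: H => x; exact: conj); move=> x /= -> [<- <-].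
  apply: aeS H2 => x Hx.
  have h1 : even_part (hartL2 u) x = even_part (hartL2 v) x := congr1 (@complex.Re R) Hx.
  have h2 : odd_part (hartL2 u) x = odd_part (hartL2 v) x.
    by apply: oppr_inj; exact: (congr1 (@complex.Im R) Hx).
  by rewrite (even_odd (hartL2 u)) h1 h2 -even_odd.
apply: nrm_eq0_ae_eq => //; rewrite -hartL2_isometry//.
have [uE vE] := (L2_hartL2 uL, L2_hartL2 vL).
have E0 : (\int[leb]_x ((hartL2 u x - hartL2 v x) ^+ 2)%:E = 0)%E.
  rewrite (ae_eq_integral (fun=> 0%E)) ?integral0//.
  - apply/measurable_EFinP; apply: measurable_funX; exact: measurable_L2 (L2B uE vE).
  - by apply: aeS E => x /= -> _; rewrite subrr expr0n.
by apply/eqP; rewrite eq_le nrm_ge0 andbT nrm_le ?E0 ?expr0n//; exact: L2B.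
Qed.

(** A hermitian function [p +i* q] is [hermitian_of (p - q)], so the preimage is
    the Hartley transform of [p - q], by involutivity. *)
Lemma plancherel_surjective_hermitian (p q : R -> R) : L2 p -> L2 q ->
  (forall x, p (- x) = p x) -> (forall x, q (- x) = - q x) ->
  exists2 u, L2 u & {ae leb, forall xi, plancherel u xi = p xi +i* q xi}.
Proof.
move=> pL qL pe qo; have pqL := L2B pL qL.
exists (hartL2 (fun x => p x - q x)); first exact: L2_hartL2.
have h := hartL2K pqL.
apply: aeS2 (plancherelE (L2_hartL2 pqL)) (aeS2 _ h (ae_reflect h));
  last by move=> x; exact: conj.
move=> x -> [h1 h2]; rewrite /fourierL2 /hermitian_of /even_part /odd_part h1 h2 pe qo.
by move: (p x) (q x) => c d; congr (_ +i* _); field.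
Qed.

End Plancherel.
#[local] Opaque plancherel.

(** * Division by a symbol *)

Section Multiplier.
Variable R : realType.
Local Notation leb := (@lebesgue_measure R).
Implicit Types f g h u v w : R -> R.
Implicit Types m : R -> R[i].

(** The inverse is the power with exponent [-1], at [0] included. *)
Lemma measurable_fun_inv_ge0 f : measurable_fun setT f -> (forall x, 0 <= f x) ->
  measurable_fun setT (fun x => (f x)^-1).
Proof.
move=> mf f0; apply: (eq_measurable_fun (fun x => f x `^ (-1))).
  by move=> x _; rewrite powR_inv1.
exact: (measurableT_comp (measurable_powR (-1)) mf).
Qed.

(** The solution is the preimage of [plancherel f / m], a hermitian function as
    [m] is.  The lower bound on [m] does double duty: it makes [m] nonzero off the
    origin, hence the solution unique, and it bounds the weight of [Hhat mu]
    times the square modulus of the quotient by [C] times the square modulus of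
    [plancherel f]. *)
Lemma symbol_equation_wellposed m (mu C : R) f : L2 f -> 0 < C ->
  measurable_fun setT (fun xi => complex.Re (m xi)) ->
  measurable_fun setT (fun xi => complex.Im (m xi)) ->
  (forall xi, m (- xi) = conjc (m xi)) ->
  (forall xi, xi != 0 ->
     1 + `|2 * pi * xi| `^ (2 * mu) <= C * Normc.normc (m xi) ^+ 2) ->
  exists_unique_ae [set u : R -> R | Hhat mu u /\
    {ae leb, forall xi, plancherel f xi = m xi * plancherel u xi}].
Proof.
move=> fL C0 mRe mIm mherm mC.
have m0 xi : xi != 0 -> m xi != 0.
  move=> /mC; apply: contraTneq => ->; rewrite Normc.normc0 expr0n mulr0 -ltNge.
  by rewrite ltr_wpDr ?powR_ge0.
have eL := L2_hartL2 fL; have [FR FI] := L2C_hermitian eL.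
pose A xi := complex.Re (m xi); pose B xi := complex.Im (m xi).
pose F := fourierL2 f.
pose P xi := complex.Re (F xi); pose Q xi := complex.Im (F xi).
pose N xi := A xi ^+ 2 + B xi ^+ 2.
(* [p +i* q] is the quotient [F / m]. *)
pose p xi := (A xi * P xi + B xi * Q xi) / N xi.
pose q xi := (A xi * Q xi - B xi * P xi) / N xi.
have AE xi : A (- xi) = A xi by rewrite /A mherm; case: (m xi).
have BE xi : B (- xi) = - B xi by rewrite /B mherm; case: (m xi).
have PE xi : P (- xi) = P xi by rewrite /P /F /fourierL2/= /even_part opprK addrC.
have QE xi : Q (- xi) = - Q xi.
  rewrite /Q /F /fourierL2/= /odd_part opprK.
  by move: (hartL2 f xi) (hartL2 f _) => a b; field.
have pE xi : p (- xi) = p xi by rewrite /p /N AE BE PE QE !sqrrN mulrNN.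
have qE xi : q (- xi) = - q xi.
  rewrite /q /N AE BE PE QE !sqrrN -[RHS]mulNr; congr (_ * _).
  by move: (A xi) (B xi) (P xi) (Q xi) => a b c d; ring.
have NE xi : N xi = Normc.normc (m xi) ^+ 2 by rewrite sqr_normcE.
have pqE xi : xi != 0 -> p xi ^+ 2 + q xi ^+ 2 = (P xi ^+ 2 + Q xi ^+ 2) / N xi.
  move=> xi0.
  have N0 : N xi != 0.
    rewrite NE expf_neq0//; apply: contra_neq (m0 _ xi0); exact: Normc.eq0_normc.
  move: N0; rewrite /p /q /N; move: (A xi) (B xi) (P xi) (Q xi) => a b c d ab0.
  by field.
have N_gt0 xi : xi != 0 -> 0 < N xi.
  move=> xi0; rewrite lt0r NE sqr_ge0 andbT expf_neq0//.
  by apply: contra_neq (m0 _ xi0); exact: Normc.eq0_normc.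
have N1 xi : xi != 0 -> (1 + `|2 * pi * xi| `^ (2 * mu)) / N xi <= C.
  by move=> xi0; rewrite ler_pdivrMr ?N_gt0// NE; exact: mC.
have mN : measurable_fun setT (fun xi => (N xi)^-1).
  apply: measurable_fun_inv_ge0; last by move=> x; rewrite NE sqr_ge0.
  by apply: measurable_funD; apply: measurable_funX.
have mP := measurable_L2 FR; have mQ := measurable_L2 FI.
have mp : measurable_fun setT p.
  apply: measurable_funM => //; apply: measurable_funD; exact: measurable_funM.
have mq : measurable_fun setT q.
  apply: measurable_funM => //; apply: measurable_funB; exact: measurable_funM.
have ne0 : {ae leb, forall x : R, x != 0} := ae_neq 0.
pose G xi := (C * (P xi ^+ 2 + Q xi ^+ 2))%:E.
have iG : leb.-integrable setT G.
  have iPQ := integrableD measurableT (integ_sqr_L2 FR) (integ_sqr_L2 FI).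
  by have := integrableZl measurableT C iPQ.
have G0 xi : (0 <= G xi)%E.
  by rewrite lee_fin mulr_ge0 ?(ltW C0)// addr_ge0 ?sqr_ge0.
have dom (k : R -> R) : measurable_fun setT k -> (forall xi, 0 <= k xi) ->
    {ae leb, forall xi, k xi <= C * (P xi ^+ 2 + Q xi ^+ 2)} ->
    (\int[leb]_xi (k xi)%:E < +oo)%E.
  move=> mk k0 kG; apply: le_lt_trans (integrable_lty measurableT iG).
  apply: ae_ge0_le_integral => //.
  - by move=> xi _; rewrite lee_fin.
  - exact/measurable_EFinP.
  - exact: (measurable_int leb iG).
  - by apply: aeS kG => xi /= kG _; rewrite lee_fin.
have wpq xi : xi != 0 ->
    (1 + `|2 * pi * xi| `^ (2 * mu)) * (p xi ^+ 2 + q xi ^+ 2) <= C * (P xi ^+ 2 + Q xi ^+ 2).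
  move=> xi0; rewrite pqE// mulrCA [leRHS]mulrC ler_wpM2l ?addr_ge0 ?sqr_ge0//.
  exact: N1.
have pq_le xi : xi != 0 -> p xi ^+ 2 + q xi ^+ 2 <= C * (P xi ^+ 2 + Q xi ^+ 2).
  move=> xi0; apply: le_trans (wpq _ xi0).
  by rewrite ler_peMl ?addr_ge0 ?sqr_ge0// lerDl powR_ge0.
have pL : L2 p.
  apply/L2P; split => //; apply: (dom (fun xi => p xi ^+ 2)) => [|xi|].
  - exact: measurable_funX.
  - exact: sqr_ge0.
  - by apply: aeS ne0 => xi xi0; rewrite (le_trans _ (pq_le _ xi0))// lerDl sqr_ge0.
have qL : L2 q.
  apply/L2P; split => //; apply: (dom (fun xi => q xi ^+ 2)) => [|xi|].
  - exact: measurable_funX.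
  - exact: sqr_ge0.
  - by apply: aeS ne0 => xi xi0; rewrite (le_trans _ (pq_le _ xi0))// lerDr sqr_ge0.
have [u uL uE] := plancherel_surjective_hermitian pL qL pE qE.
have mE xi : m xi = A xi +i* B xi by rewrite /A /B; case: (m xi).
have FE xi : fourierL2 f xi = P xi +i* Q xi by [].
have sol : {ae leb, forall xi, plancherel f xi = m xi * plancherel u xi}.
  apply: (aeS2 _ (plancherelE fL) (aeS2 _ uE ne0)); last by move=> x; exact: conj.
  move=> xi -> [-> xi0]; have := N_gt0 _ xi0; move/lt0r_neq0.
  rewrite FE mE /p /q /N; move: (A xi) (B xi) (P xi) (Q xi) => a b c d ab0.
  by apply/eqP; rewrite eq_complex/=; apply/andP; split; apply/eqP; field.
exists u.
  split => //; split => //.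
  have [PL _ _] := plancherel_isometric_extension R.
  have [uR uI] := PL _ uL.
  apply: dom => [|xi|].
  - apply: measurable_funM.
      apply: measurable_funD; first exact: measurable_cst.
      apply: (measurableT_comp (measurable_powR (2 * mu))).
      by apply: measurableT_comp => //; exact: measurable_funM.
    rewrite (_ : (fun xi => _) = fun xi =>
      complex.Re (plancherel u xi) ^+ 2 + complex.Im (plancherel u xi) ^+ 2).
      by apply: measurable_funD; apply: measurable_funX; exact: measurable_L2.
    by apply/funext => xi; rewrite sqr_normcE.
  - by rewrite mulr_ge0 ?sqr_ge0// addr_ge0 ?powR_ge0.
  - apply: aeS2 uE ne0 => xi -> xi0; rewrite sqr_normcE; exact: wpq.
move=> v [[vL _] vsol]; apply: plancherel_inj => //.
apply: (aeS2 _ sol (aeS2 _ vsol ne0)); last by move=> x; exact: conj.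
move=> xi h1 [h2 xi0]; apply: (mulfI (m0 _ xi0)).
by rewrite -h1 -h2.
Qed.

End Multiplier.

(** * The two symbols *)

Section Symbols.
Variable R : realType.
Local Notation leb := (@lebesgue_measure R).

Lemma measurable_sgr : measurable_fun setT (@Num.sg R).
Proof.
apply: nondecreasing_measurable => // x y xy.
have [x0|x0|x0] := ltgtP x 0.
- rewrite [leLHS]ltr0_sg//; have [y0|y0|->] := ltgtP y 0.
  + by rewrite ltr0_sg.
  + by rewrite gtr0_sg// lerN10.
  + by rewrite sgr0 lerN10.
- by rewrite !gtr0_sg// (lt_le_trans x0).
- by rewrite x0 sgr0 sgr_ge0 -x0.
Qed.

Lemma ipowN (x sigma : R) : ipow (- x) sigma = conjc (ipow x sigma).
Proof.
rewrite /ipow normrN /expi sgrN mulrN mulNr cosN sinN.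
by apply/eqP; rewrite eq_complex/=; apply/andP; split; apply/eqP; ring.
Qed.

(** Both square moduli below are read off this cartesian form. *)
Lemma ipowE (x sigma : R) :
  ipow x sigma = (`|x| `^ sigma * cos (sigma * pi * Num.sg x / 2)) +i*
                 (`|x| `^ sigma * sin (sigma * pi * Num.sg x / 2)).
Proof.
by rewrite /ipow /expi; apply/eqP; rewrite eq_complex/= !mul0r subr0 addr0 !eqxx.
Qed.

Lemma measurable_abs_powR (sigma : R) :
  measurable_fun setT (fun xi : R => `|2 * pi * xi| `^ sigma).
Proof.
apply: (measurableT_comp (measurable_powR sigma)).
by apply: measurableT_comp => //; exact: measurable_funM.
Qed.

Lemma measurable_phase (sigma : R) :
  measurable_fun setT (fun xi : R => sigma * pi * Num.sg (2 * pi * xi) / 2).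
Proof.
apply: measurable_funM => //; apply: measurable_funM => //.
by apply: (measurableT_comp measurable_sgr); exact: measurable_funM.
Qed.

Lemma measurable_Re_ipow (sigma : R) :
  measurable_fun setT (fun xi : R => complex.Re (ipow (2 * pi * xi) sigma)).
Proof.
rewrite (_ : (fun xi => _) = fun xi => `|2 * pi * xi| `^ sigma *
  cos (sigma * pi * Num.sg (2 * pi * xi) / 2)); last first.
  by apply/funext => xi; rewrite ipowE.
apply: measurable_funM; first exact: measurable_abs_powR.
apply: (measurableT_comp _ (measurable_phase sigma)).
by apply: continuous_measurable_fun; exact: continuous_cos.
Qed.

Lemma measurable_Im_ipow (sigma : R) :
  measurable_fun setT (fun xi : R => complex.Im (ipow (2 * pi * xi) sigma)).
Proof.
rewrite (_ : (fun xi => _) = fun xi => `|2 * pi * xi| `^ sigma *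
  sin (sigma * pi * Num.sg (2 * pi * xi) / 2)); last first.
  by apply/funext => xi; rewrite ipowE.
apply: measurable_funM; first exact: measurable_abs_powR.
apply: (measurableT_comp _ (measurable_phase sigma)).
by apply: continuous_measurable_fun; exact: continuous_sin.
Qed.

(** The weight is [1 + a ^ 2] or [1 + b ^ 2] according to the sign of [s], where
    [a = r ^ s] and [b = r ^ (- s)]; as [a b = 1], the sum [a ^ 2 + b ^ 2] is at
    least [1] and at least each of its terms. *)
Lemma weight_le_powR (r s : R) : 0 < r ->
  1 + r `^ (2 * `|s|) <= 2 * ((r `^ s) ^+ 2 + (r `^ (- s)) ^+ 2).
Proof.
move=> r0; have ab : r `^ s * r `^ (- s) = 1.
  by rewrite -powRD ?(gt_eqF r0) ?implybT// subrr powRr0.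
have sq t : r `^ (2 * t) = (r `^ t) ^+ 2.
  by rewrite mulrC powRrM powR_mulrn// powR_ge0.
have key (a b : R) : a * b = 1 -> 1 + a ^+ 2 <= 2 * (a ^+ 2 + b ^+ 2).
  move=> ab1; rewrite -subr_ge0.
  have -> : 2 * (a ^+ 2 + b ^+ 2) - (1 + a ^+ 2) = (a - b) ^+ 2 + 2 * (a * b) - 1 + b ^+ 2.
    by ring.
  by rewrite ab1; have := sqr_ge0 (a - b); have := sqr_ge0 b; lra.
have [s0|s0] := ger0P s; rewrite sq; first exact: key.
by rewrite [X in 2 * X]addrC key// mulrC.
Qed.

(** The two terms of this symbol have the same argument, so their moduli add. *)
Lemma weight_le_symbol1 (x s : R) : x != 0 ->
  1 + `|x| `^ (2 * `|s|) <= 2 * Normc.normc (ipow x (- s) + ipow (- x) s) ^+ 2.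
Proof.
move=> x0; have r0 : 0 < `|x| by rewrite normr_gt0.
apply: (le_trans (weight_le_powR s r0)); rewrite ler_wpM2l//.
rewrite sqr_normcE ipowN !ipowE !mulNr cosN sinN/=.
set a := `|x| `^ s; set b := `|x| `^ (- s); set t := s * pi * _ / 2.
have -> : (b * cos t + a * cos t) ^+ 2 + (b * - sin t - a * sin t) ^+ 2 =
    (a + b) ^+ 2 * (cos t ^+ 2 + sin t ^+ 2) by ring.
rewrite cos2Dsin2 mulr1 sqrrD addrAC lerDl mulrn_wge0// mulr_ge0 ?powR_ge0//.
Qed.

(** The two terms of this symbol have opposite arguments [- t] and [t], with
    [|2 t| = |s| pi]; they do not cancel because [|s| <= 1 / 2] makes
    [cos (2 t)] nonnegative. *)
Lemma weight_le_symbol2 (x s : R) : - (1 / 2) < s < 1 / 2 -> x != 0 ->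
  1 + `|x| `^ (2 * `|s|) <= 2 * Normc.normc (ipow x (- s) + ipow x s) ^+ 2.
Proof.
move=> /andP[s1 s2] x0; have r0 : 0 < `|x| by rewrite normr_gt0.
apply: (le_trans (weight_le_powR s r0)); rewrite ler_wpM2l//.
rewrite sqr_normcE !ipowE !mulNr cosN sinN/=.
have : `|x| `^ s * `|x| `^ (- s) = 1.
  by rewrite -powRD ?(gt_eqF r0) ?implybT// subrr powRr0.
set a := `|x| `^ s; set b := `|x| `^ (- s); set t := s * pi * _ / 2 => ab.
have -> : (b * cos t + a * cos t) ^+ 2 + (b * - sin t + a * sin t) ^+ 2 =
    (a ^+ 2 + b ^+ 2) * (cos t ^+ 2 + sin t ^+ 2) + 2 * (a * b) * (cos t ^+ 2 - sin t ^+ 2).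
  by ring.
rewrite cos2Dsin2 mulr1 lerDl ab mulr1 mulr_ge0//.
have -> : cos t ^+ 2 - sin t ^+ 2 = cos (t + t) by rewrite cosD !expr2.
rewrite /t; have -> : s * pi * Num.sg x / 2 + s * pi * Num.sg x / 2 = s * pi * Num.sg x.
  by move: (pi : R) => p; field.
have c0 : 0 <= cos (s * pi).
  rewrite cos_ge0_pihalf//; have := @pi_gt0 R; move: (pi : R) => p p0.
  by apply/andP; split; nra.
have [|] := ltP x 0 => x1; first by rewrite ltr0_sg// mulrN1 cosN.
by rewrite gtr0_sg ?mulr1// lt_neqAle eq_sym x0.
Qed.

End Symbols.

Theorem corollary5p1 (R : realType) (s : R) (f : R -> R)
    (hs : - (1 / 2) < s < 1 / 2) (hf : L2 f) :
  exists_unique_ae [set u : R -> R | Hhat `|s| u /\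
    {ae @lebesgue_measure R, forall xi : R,
      plancherel f xi =
        (ipow (2 * pi * xi) (- s) + ipow (- (2 * pi * xi)) s)
          * plancherel u xi}] /\
  exists_unique_ae [set u : R -> R | Hhat `|s| u /\
    {ae @lebesgue_measure R, forall xi : R,
      plancherel f xi =
        (ipow (2 * pi * xi) (- s) + ipow (2 * pi * xi) s)
          * plancherel u xi}].
Proof.
have arg0 (xi : R) : xi != 0 -> 2 * pi * xi != 0.
  by move=> xi0; rewrite !mulf_neq0// gt_eqF ?pi_gt0.
have conjD (z w : R[i]) : conjc (z + w) = conjc z + conjc w.
  by case: z w => a b [c d]; apply/eqP; rewrite eq_complex/= opprD !eqxx.
split.
- apply: (symbol_equation_wellposed (m := fun xi =>
    ipow (2 * pi * xi) (- s) + ipow (- (2 * pi * xi)) s) (C := 2)) => //.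
  + rewrite (_ : (fun xi => _) = fun xi =>
      complex.Re (ipow (2 * pi * xi) (- s)) + complex.Re (ipow (2 * pi * xi) s)).
      by apply: measurable_funD; exact: measurable_Re_ipow.
    by apply/funext => xi; rewrite ipowN !ipowE.
  + rewrite (_ : (fun xi => _) = fun xi =>
      complex.Im (ipow (2 * pi * xi) (- s)) - complex.Im (ipow (2 * pi * xi) s)).
      by apply: measurable_funB; exact: measurable_Im_ipow.
    by apply/funext => xi; rewrite ipowN !ipowE.
  + by move=> xi; rewrite mulrN conjD -!ipowN.
  + by move=> xi xi0; apply: weight_le_symbol1; exact: arg0.
- apply: (symbol_equation_wellposed (m := fun xi =>
    ipow (2 * pi * xi) (- s) + ipow (2 * pi * xi) s) (C := 2)) => //.
  + rewrite (_ : (fun xi => _) = fun xi =>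
      complex.Re (ipow (2 * pi * xi) (- s)) + complex.Re (ipow (2 * pi * xi) s)).
      by apply: measurable_funD; exact: measurable_Re_ipow.
    by apply/funext => xi; rewrite !ipowE.
  + rewrite (_ : (fun xi => _) = fun xi =>
      complex.Im (ipow (2 * pi * xi) (- s)) + complex.Im (ipow (2 * pi * xi) s)).
      by apply: measurable_funD; exact: measurable_Im_ipow.
    by apply/funext => xi; rewrite !ipowE.
  + by move=> xi; rewrite mulrN conjD -!ipowN.
  + by move=> xi xi0; apply: weight_le_symbol2 => //; exact: arg0.
Qed.
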